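(* Suppose $(M,g(t))$ is a complete $n$-dimensional Ricci flow defined on $[0,T)$. Then for any pair of space-time points $(p,t),(q,s)\in M\times[0,T)$ we have $$|r_{\mathrm{Rm}}(p,t)-r_{\mathrm{Rm}}(q,s)|\le\min\{d_{g(t)}(p,q),d_{g(s)}(p,q)\}+C_1|t-s|^{1/2},$$ where $C_1$ is a constant depending only on the dimension $n$.
   Context: A Ricci flow $(M^n,g(t))_{t\in[0,T)}$ is a smooth one-parameter family of $n$-dimensional Riemannian manifolds with $\partial_t g(t)=-2\mathrm{Ric}_{g(t)}$; complete means every $g(t)$ is complete. Parabolic cylinder: $\mathcal P(p,t,r):=B_{g(t)}(p,r)\times(\max\{t-r^2,0\},\min\{t+r^2,T\})$. Riemann scale: $r_{\mathrm{Rm}}(p,t):=\sup\{r>0 \mid |\mathrm{Rm}|<r^{-2}\text{ on }\mathcal P(p,t,r)\}$, with $r_{\mathrm{Rm}}(p,t)=+\infty$ if $(M,g(t))$ is flat for every $t\in[0,T)$. *)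

(* Defs.v *)
(* MathComp / MathComp-Analysis. *)
From HB Require Import structures.
From mathcomp Require Import all_boot all_order all_algebra.
From mathcomp Require Import all_classical all_reals all_analysis.
Set Implicit Arguments.
Unset Strict Implicit.
Unset Printing Implicit Defensive.
Import Order.TTheory GRing.Theory Num.Theory.
Import numFieldNormedType.Exports.
Local Open Scope classical_set_scope.
Local Open Scope ring_scope.

Section Smoothness.
Context {R : realType} {V W : normedModType R}.

(* [f] is C^k on [A], for [A] open: all iterated directional derivatives of
   order at most [k] exist and are continuous on [A].  In finite dimension this
   is the usual notion. *)
Fixpoint Ck (k : nat) (A : set V) (f : V -> W) : Prop :=
  (forall x, A x -> {for x, continuous f}) /\
  match k with
  | 0 => True
  | k'.+1 => (forall x v, A x -> derivable f x v) /\
             (forall v, Ck k' A (fun x => 'D_v f x))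
  end.

Definition smooth (A : set V) (f : V -> W) : Prop := forall k, Ck k A f.

(* On a set which need not be open, regularity means that near each point of
   the set there is an extension to an open set with that regularity. *)
Definition Ck_on (k : nat) (A : set V) (f : V -> W) : Prop :=
  forall x, A x -> exists U : set V, exists F : V -> W,
    [/\ open U, U x, Ck k U F & forall y, U y -> A y -> F y = f y].

Definition smooth_on (A : set V) (f : V -> W) : Prop :=
  forall x, A x -> exists U : set V, exists F : V -> W,
    [/\ open U, U x, smooth U F & forall y, U y -> A y -> F y = f y].

End Smoothness.

(* Smooth connected n-manifolds without boundary, given by an atlas.  The values
   of [coord a] outside [dom a], and of [param a] outside the image of
   [coord a], are irrelevant. *)
Record manifold (R : realType) (n : nat) := Manifold {
  points :> topologicalType;
  chart : Type;
  dom : chart -> set points;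
  coord : chart -> points -> 'rV[R]_n;
  param : chart -> 'rV[R]_n -> points;
  dom_open : forall a, open (dom a);
  image_open : forall a, open (coord a @` dom a);
  coordK : forall a x, dom a x -> param a (coord a x) = x;
  coord_continuous : forall a x, dom a x -> {for x, continuous (coord a)};
  param_continuous : forall a z, (coord a @` dom a) z ->
    {for z, continuous (param a)};
  chart_cover : forall x, exists a, dom a x;
  transition_smooth : forall a b,
    smooth (coord a @` (dom a `&` dom b)) (coord b \o param a);
  manifold_hausdorff : hausdorff_space points;
  manifold_countable : @second_countable points;
  manifold_connected : connected [set: points]
}.

Section LocalGeometry.
Context {R : realType} {n : nat}.

Definition partial (i : 'I_n) (f : 'rV[R]_n -> R) (x : 'rV[R]_n) : R :=
  'D_(delta_mx 0 i) f x.

Definition quad_form (A : 'M[R]_n) (v : 'rV[R]_n) : R := (v *m A *m v^T) 0 0.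

(* Below, [h] is the matrix (g_ij) of a metric in one coordinate system. *)
Variable h : 'rV[R]_n -> 'M[R]_n.

(* Gamma^k_{ij} = 1/2 g^{kl} (d_i g_{jl} + d_j g_{il} - d_l g_{ij}) *)
Definition christoffel (k i j : 'I_n) (x : 'rV[R]_n) : R :=
  2^-1 * \sum_(l < n) invmx (h x) k l *
    (partial i (fun y => h y j l) x + partial j (fun y => h y i l) x
     - partial l (fun y => h y i j) x).

(* R_{ijk}^l, with R(d_i, d_j) d_k = R_{ijk}^l d_l and
   R(X, Y) = [nabla_X, nabla_Y] - nabla_[X, Y] *)
Definition riemann (i j k l : 'I_n) (x : 'rV[R]_n) : R :=
  partial i (christoffel l j k) x - partial j (christoffel l i k) x
  + \sum_(m < n) (christoffel m j k x * christoffel l i m x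
                  - christoffel m i k x * christoffel l j m x).

(* Ric(Y, Z) = tr (X |-> R(X, Y) Z), positive on round spheres *)
Definition ricci (j k : 'I_n) (x : 'rV[R]_n) : R :=
  \sum_(i < n) riemann i j k i x.

(* |Rm|^2 = g^{ia} g^{jb} g^{kc} g_{ld} R_{ijk}^l R_{abc}^d *)
Definition riemann_norm (x : 'rV[R]_n) : R :=
  Num.sqrt (\sum_(i < n) \sum_(j < n) \sum_(k < n) \sum_(l < n)
            \sum_(a < n) \sum_(b < n) \sum_(c < n) \sum_(d < n)
    invmx (h x) i a * invmx (h x) j b * invmx (h x) k c * h x l d *
    riemann i j k l x * riemann a b c d x).

End LocalGeometry.

Section Riemannian.
Context {R : realType} {n : nat} (M : manifold R n).

(* A symmetric 2-tensor field is given by its component matrices in all charts;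
   [tensor_law] says that they transform as the components of a covariant
   2-tensor under change of coordinates. *)
Definition field2 := chart M -> 'rV[R]_n -> 'M[R]_n.

Definition jacobian (a b : chart M) (z : 'rV[R]_n) : 'M[R]_n :=
  \matrix_(i, k) partial i (fun y => coord b (param a y) 0 k) z.

Definition tensor_law (h : field2) : Prop :=
  forall a b x, dom a x -> dom b x ->
    let J := jacobian a b (coord a x) in
    h a (coord a x) = J *m h b (coord b x) *m J^T.

Definition is_metric (h : field2) : Prop :=
  [/\ forall a i j, smooth (coord a @` dom a) (fun z => h a z i j),
      forall a z, (coord a @` dom a) z -> (h a z)^T = h a z,
      forall a z v, (coord a @` dom a) z -> v != 0 -> 0 < quad_form (h a z) v
    & tensor_law h].

Definition flat (h : field2) : Prop :=
  forall a x i j k l, dom a x -> riemann (h a) i j k l (coord a x) = 0.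

(* |Rm| < c at [x]; as |Rm| does not depend on the coordinates, it may be
   computed in any chart around [x]. *)
Definition riemann_lt (h : field2) (x : M) (c : R) : Prop :=
  exists2 a, dom a x & riemann_norm (h a) (coord a x) < c.

Definition chart_at (x : M) : chart M := projT1 (cid (chart_cover x)).

Definition C1_on_segment (gamma : R^o -> M) (u v : R) : Prop :=
  forall w, u <= w <= v -> exists a, exists U : set R^o,
    [/\ open U, U w,
        forall w', U w' -> u <= w' <= v -> dom a (gamma w')
      & Ck_on 1 (U `&` [set w' | u <= w' <= v]) (coord a \o gamma)].

(* Piecewise C^1 curves [0, 1] -> M from [p] to [q]. *)
Definition path_from_to (p q : M) (gamma : R^o -> M) : Prop :=
  [/\ {within `[0, 1], continuous gamma}, gamma 0 = p, gamma 1 = q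
    & exists2 s : seq R, itv_partition 0 1 s &
        forall i, (i < size s)%N ->
          C1_on_segment gamma (nth 0 (0 :: s) i) (nth 0 (0 :: s) i.+1)].

(* The norm of the velocity; its values at the finitely many break points and at
   the end points do not matter for the length. *)
Definition speed (h : field2) (gamma : R^o -> M) (u : R^o) : R :=
  let a := chart_at (gamma u) in
  Num.sqrt (quad_form (h a (coord a (gamma u))) ('D_1 (coord a \o gamma) u)).

Definition curve_length (h : field2) (gamma : R^o -> M) : \bar R :=
  (\int[lebesgue_measure]_(u in `[0%R, 1%R]) (speed h gamma u)%:E)%E.

Definition dist (h : field2) (p q : M) : \bar R :=
  ereal_inf [set curve_length h gamma | gamma in path_from_to p q].

Definition complete_metric (h : field2) : Prop :=
  forall u : nat -> M,
    (forall e : R, 0 < e -> exists N, forall i j, (N <= i)%N -> (N <= j)%N ->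
       (dist h (u i) (u j) < e%:E)%E) ->
    exists x : M, forall e : R, 0 < e ->
      exists N, forall i, (N <= i)%N -> (dist h (u i) x < e%:E)%E.

(* [0, T), with T finite or infinite *)
Definition times (T : \bar R) : set R := [set t | 0 <= t /\ (t%:E < T)%E].

(* Joint smoothness is up to t = 0, where the time derivative is one-sided. *)
Definition ricci_flow (T : \bar R) (g : R -> field2) : Prop :=
  [/\ (0 < T)%E,
      forall t, times T t -> is_metric (g t),
      forall a i j,
        smooth_on [set z : R^o * 'rV[R]_n |
                     times T z.1 /\ (coord a @` dom a) z.2]
                  (fun z => g z.1 a z.2 i j : R^o)
    & forall t a z i j, times T t -> (coord a @` dom a) z ->
        (fun e : R => e^-1 * (g (t + e) a z i j - g t a z i j))
          @ within [set e | times T (t + e)] 0^'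
          --> - 2 * ricci (g t a) i j z].

Definition parabolic_cylinder (T : \bar R) (g : R -> field2)
    (p : M) (t r : R) : set (M * R) :=
  [set x : M | (dist (g t) p x < r%:E)%E] `*`
  [set s : R | Num.max (t - r ^+ 2) 0 < s /\
               (s%:E < mine (t + r ^+ 2)%:E T)%E].

Definition riemann_scale (T : \bar R) (g : R -> field2)
    (p : M) (t : R) : \bar R :=
  if `[< forall s, times T s -> flat (g s) >] then +oo%E
  else ereal_sup [set r%:E | r in [set r : R | 0 < r /\
         forall x s, parabolic_cylinder T g p t r (x, s) ->
           riemann_lt (g s) x (r ^- 2)]].

End Riemannian.

(* |x - y| on extended reals, with the convention |oo - oo| = 0 (in the library
   +oo - +oo = -oo, so that its absolute value would be +oo). *)
Definition abs_diff {R : realType} (x y : \bar R) : \bar R :=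
  (if x == y then 0 else `|x - y|)%E.

(* Main.v *)
(* The scale is 1-Lipschitz in space by the triangle inequality for d_{g(t)}.
   In time, let |Rm| < r^{-2} on the cylinder of radius r around (p, t).  There
   |Ric| <= n^3 r^{-2}, so the flow equation makes g(t) and g(s) comparable on
   B_{g(t)}(p, r) up to the factor exp(2 n^3 r^{-2} |t - s|).  A path from p that
   is short for g(s) cannot reach g(t)-length r: the prefix of it whose
   g(t)-length is slightly below r stays inside B_{g(t)}(p, r), where the two
   metrics are comparable.  Hence the cylinder of radius
   r - (n^3 + 1) |t - s|^{1/2} around (p, s) is contained in the one of radius r
   around (p, t).  It remains to know that the scale is positive, so that the
   supremum defining it is not taken over the empty set: |Rm| is locally bounded
   in space-time, and small metric balls lie in coordinate neighbourhoods. *)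
From HB Require Import structures.
From mathcomp Require Import all_boot all_order all_algebra.
From mathcomp Require Import all_classical all_reals all_analysis.
From mathcomp Require Import ring lra.
Require Import Defs.
Set Implicit Arguments.
Unset Strict Implicit.
Unset Printing Implicit Defensive.
Import Order.TTheory GRing.Theory Num.Theory.
Import numFieldNormedType.Exports.
Local Open Scope classical_set_scope.
Local Open Scope ring_scope.

(** * Positive definite forms and the trace of the curvature tensor *)

(** Lengths are handled without integral estimates: the length of a piecewise C^1 curve is the
    increment of any continuous function whose derivative is the speed off a finite set. Reversing,
    joining, cutting and comparing curves then amounts to differentiating such a function and
    applying one monotonicity lemma. The n^3 counts the terms of Ric(v, v) in an orthonormal frame,
    each at most |v|^2 |Rm|. The flow equation doubles it in the exponent for the quadratic form,
    and the square root taken for lengths halves it again. The summand 1 keeps the constant at least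
    1 in every dimension, so that shrinking the radius also makes the time windows of the two
    cylinders nest. For small balls, the obstacle is that a short curve might leave the chart at a
    point where the coordinates mean nothing. A compact coordinate ball and the Hausdorff property
    exclude this. *)

Lemma quad_formE (R : realType) n (A : 'M[R]_n) v :
  quad_form A v = \sum_i \sum_j v 0 i * v 0 j * A i j.
Proof.
rewrite /quad_form mxE exchange_big /=; apply: eq_bigr => j _.
rewrite mxE big_distrl /=; apply: eq_bigr => i _.
by rewrite mxE; ring.
Qed.

Lemma quad_form_mulmx (R : realType) n (A J : 'M[R]_n) v :
  quad_form A (v *m J) = quad_form (J *m A *m J^T) v.
Proof. by rewrite /quad_form trmx_mul !mulmxA. Qed.

Lemma quad_form_gram (R : realType) n (A : 'M[R]_n) v :
  quad_form (A *m A^T) v = \sum_i (v *m A) 0 i ^+ 2.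
Proof.
rewrite /quad_form mulmxA -mulmxA -trmx_mul mxE.
by apply: eq_bigr => i _; rewrite [X in _ * X]mxE expr2.
Qed.

Definition posdef (R : realType) n (h : 'M[R]_n) :=
  h^T = h /\ forall v, v != 0 -> 0 < quad_form h v.

(** Induction on the size through the Schur complement of the first diagonal entry. The factor
    stands for an orthonormal frame: the rows of its inverse are orthonormal for [h], and [v *m A]
    lists the coordinates of [v] in that frame. *)
Lemma cholesky (R : realType) n (h : 'M[R]_n) : posdef h ->
  exists2 A : 'M[R]_n, A \in unitmx & h = A *m A^T.
Proof.
elim: n h => [|n IHn] h [hs hp].
  by exists 1%:M; [exact: unitmx1|apply/matrixP => -[]].
change 'M[R]_(1 + n) in h.
set a := h 0 0; set b := ursubmx h; set d := drsubmx h.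
have hE : h = block_mx a%:M b b^T d.
  rewrite -[LHS]submxK; congr block_mx.
    by rewrite [LHS]mx11_scalar !mxE lshift0.
  by rewrite /b trmx_ursub hs.
have a_gt0 : 0 < a.
  have := hp (delta_mx 0 0); rewrite quad_formE.
  rewrite (bigD1 0)//= [X in _ + X]big1; last first.
    by move=> i i0; rewrite big1// => j _; rewrite mxE (negPf i0) andbF mul0r mul0r.
  rewrite (bigD1 0)//= [X in _ + X + _]big1; last first.
    by move=> i i0; rewrite !mxE (negPf i0) !andbF mulr0 mul0r.
  rewrite !mxE /= !mul1r !addr0; apply.
  by apply/eqP => /matrixP/(_ 0 0); rewrite !mxE => /eqP; rewrite oner_eq0.
pose s := Num.sqrt a.
have s_gt0 : 0 < s by rewrite sqrtr_gt0.
have ss : s * s = a by rewrite -expr2 sqr_sqrtr// ltW.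
have [A' A'u A'E] : exists2 A : 'M[R]_n, A \in unitmx &
    d - a^-1 *: (b^T *m b) = A *m A^T.
  apply: IHn; split.
    rewrite linearB linearZ /= trmx_mul trmxK; congr (_ - _).
    by rewrite /d trmx_drsub hs.
  move=> v v0.
  (* Completing the square: for given last coordinates [v], this first coordinate minimises the form
     [h], and the minimum is the Schur complement at [v]. *)
  pose c : 'rV[R]_1 := - a^-1 *: (v *m b^T).
  have -> : quad_form (d - a^-1 *: (b^T *m b)) v = quad_form h (row_mx c v).
    have cz : c *m a%:M + v *m b^T = 0.
      by rewrite mul_mx_scalar /c scalerA mulrN divff ?gt_eqF// scaleN1r addNr.
    rewrite /quad_form hE tr_row_mx mul_row_block mul_row_col cz mul0mx add0r.
    congr ((_ *m _) 0 0).
    by rewrite mulmxBr -scalemxAr mulmxA /c -scalemxAl scaleNr addrC.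
  apply: hp; apply/eqP => rz.
  have := congr1 (@rsubmx _ 1 1 n) rz; rewrite row_mxKr => v0'.
  by move: v0; rewrite v0' linear0 eqxx.
pose A : 'M[R]_(1 + n) := block_mx s%:M 0 (s^-1 *: b^T) A'.
have Au : A \in unitmx.
  rewrite unitmxE (det_lblock s%:M) det_scalar1 unitrM -unitmxE A'u andbT.
  by rewrite unitfE gt_eqF.
exists A => //; change (h = (A : 'M[R]_(1 + n)) *m A^T).
rewrite /A tr_block_mx mulmx_block hE trmx0 !mul0mx !mulmx0 !addr0.
rewrite tr_scalar_mx -scalar_mxM ss; congr block_mx.
- rewrite linearZ /= trmxK mul_scalar_mx scalerA mulfV ?scale1r// gt_eqF//.
- by rewrite mul_mx_scalar scalerA mulfV ?scale1r// gt_eqF.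
- rewrite -A'E linearZ /= trmxK -scalemxAl -scalemxAr scalerA.
  by rewrite -invfM ss addrCA subrr addr0.
Qed.

Lemma posdef_unitmx (R : realType) n (h : 'M[R]_n) : posdef h -> h \in unitmx.
Proof. by case/cholesky => A Au ->; rewrite unitmx_mul unitmx_tr Au. Qed.

Lemma sum4E (R : realType) n (F : 'I_n -> 'I_n -> 'I_n -> 'I_n -> R) :
  \sum_i \sum_j \sum_k \sum_l F i j k l =
  \sum_(x : 'I_n * 'I_n * 'I_n * 'I_n) F x.1.1.1 x.1.1.2 x.1.2 x.2.
Proof. by rewrite !pair_bigA. Qed.

Lemma prod_sum4 (R : realType) n (a b c d : 'I_n -> R) :
  (\sum_i a i) * (\sum_j b j) * (\sum_k c k) * (\sum_l d l) =
  \sum_i \sum_j \sum_k \sum_l a i * b j * c k * d l.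
Proof.
rewrite -!mulrA mulr_suml; apply: eq_bigr => i _.
rewrite mulr_suml mulr_sumr; apply: eq_bigr => j _.
rewrite mulr_suml !mulr_sumr; apply: eq_bigr => k _.
by rewrite !mulr_sumr; apply: eq_bigr => l _; rewrite !mulrA.
Qed.

Lemma contract_delta (R : realType) n (P : 'M[R]_n) (F : 'I_n -> 'I_n -> R) :
  P = 1%:M -> \sum_i \sum_l P l i * F i l = \sum_i F i i.
Proof.
move=> ->; apply: eq_bigr => i _.
rewrite (bigD1 i)//= big1 ?addr0 ?mxE ?eqxx ?mul1r// => l li.
by rewrite mxE (negPf li) mul0r.
Qed.

(* In an orthonormal frame [h = A A^T] the full contraction of a tensor is the
   sum of the squares of its components [S]. *)
Lemma ricci_contraction_bound (R : realType) n (h : 'M[R]_n)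
    (T : 'I_n -> 'I_n -> 'I_n -> 'I_n -> R) (v : 'rV[R]_n) : posdef h ->
  `|\sum_j \sum_k v 0 j * v 0 k * \sum_i T i j k i| <= n%:R ^+ 3 * quad_form h v *
    Num.sqrt (\sum_i \sum_j \sum_k \sum_l \sum_a \sum_b \sum_c \sum_d
      invmx h i a * invmx h j b * invmx h k c * h l d * T i j k l * T a b c d).
Proof.
case/cholesky => A Au hE; set B := invmx A.
have GE i a : invmx h i a = \sum_p B p i * B p a.
  have -> : invmx h = B^T *m B.
    have hu : h \in unitmx by rewrite hE unitmx_mul unitmx_tr Au.
    have E1 : h *m (B^T *m B) = 1%:M.
      rewrite hE -!mulmxA [A^T *m _]mulmxA -trmx_mul mulVmx// trmx1 mul1mx.
      by rewrite mulmxV.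
    by rewrite -[RHS](mulKmx hu) E1 mulmx1.
  by rewrite mxE; apply: eq_bigr => p _; rewrite mxE.
have HE l d : h l d = \sum_s A l s * A d s.
  by rewrite hE mxE; apply: eq_bigr => p _; rewrite mxE.
(* Passage to the orthonormal frame on tensors of type (3, 1): the three covariant slots transform
   by [B], the contravariant one by its inverse [A]. *)
pose E p i : R := B p.1.1.1 i.1.1.1 * B p.1.1.2 i.1.1.2 * B p.1.2 i.1.2 *
  A i.2 p.2.
pose t (i : 'I_n * 'I_n * 'I_n * 'I_n) := T i.1.1.1 i.1.1.2 i.1.2 i.2.
pose S p := \sum_i E p i * t i.
have normE : \sum_i \sum_j \sum_k \sum_l \sum_a \sum_b \sum_c \sum_d
      invmx h i a * invmx h j b * invmx h k c * h l d * T i j k l * T a b c d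
   = \sum_p S p ^+ 2.
  rewrite sum4E; under eq_bigr do rewrite sum4E.
  transitivity (\sum_i \sum_a \sum_p (E p i * t i) * (E p a * t a)).
    apply: eq_bigr => i _; apply: eq_bigr => a _.
    rewrite !GE HE.
    suff -> : (\sum_p B p i.1.1.1 * B p a.1.1.1) *
        (\sum_p B p i.1.1.2 * B p a.1.1.2) * (\sum_p B p i.1.2 * B p a.1.2) *
        (\sum_s A i.2 s * A a.2 s) = \sum_p E p i * E p a.
      by rewrite -mulrA mulr_suml; apply: eq_bigr => p _; rewrite /t; ring.
    rewrite -(sum4E (fun p q r s => B p i.1.1.1 * B q i.1.1.2 * B r i.1.2 *
      A i.2 s * (B p a.1.1.1 * B q a.1.1.2 * B r a.1.2 * A a.2 s))).
    rewrite prod_sum4; do 4!apply: eq_bigr => ? _; ring.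
  under eq_bigr do rewrite exchange_big /=.
  rewrite exchange_big /=; apply: eq_bigr => p _.
  rewrite expr2 /S big_distrlr /=; apply: eq_bigr => i _.
  by apply: eq_bigr => a _.
rewrite normE; set N := Num.sqrt _.
have S_le p : `|S p| <= N.
  rewrite -sqrtr_sqr ler_sqrt; last by apply: sumr_ge0 => x _; exact: sqr_ge0.
  by rewrite (bigD1 p)//= lerDl; apply: sumr_ge0 => x _; exact: sqr_ge0.
set w := v *m A.
have qE : quad_form h v = \sum_i w 0 i ^+ 2 by rewrite hE quad_form_gram.
have w_le i : `|w 0 i| <= Num.sqrt (quad_form h v).
  rewrite qE -sqrtr_sqr ler_sqrt; last by apply: sumr_ge0 => x _; exact: sqr_ge0.
  by rewrite (bigD1 i)//= lerDl; apply: sumr_ge0 => x _; exact: sqr_ge0.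
have q_ge0 : 0 <= quad_form h v by rewrite qE; apply: sumr_ge0 => x _; exact: sqr_ge0.
have vE j : v 0 j = \sum_q w 0 q * B q j.
  by rewrite -[v in LHS](mulmxK Au) mxE.
(* The trace over the first and the last slot does not depend on the frame: one of these slots
   carries [A], the other [B], and [A *m B] is the identity. *)
have -> : \sum_j \sum_k v 0 j * v 0 k * \sum_i T i j k i =
    \sum_p \sum_q \sum_r w 0 q * w 0 r * S (p, q, r, p).
  transitivity (\sum_j \sum_k \sum_q \sum_r
      w 0 q * w 0 r * (B q j * B r k * \sum_i T i j k i)).
    apply: eq_bigr => j _; apply: eq_bigr => k _; rewrite !vE !mulr_suml.
    apply: eq_bigr => q _; rewrite mulr_sumr mulr_suml; apply: eq_bigr => r _.
    by ring.
  rewrite [RHS]exchange_big /=.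
  under [RHS]eq_bigr do rewrite exchange_big /=.
  under eq_bigr do rewrite exchange_big /=.
  rewrite exchange_big /=; apply: eq_bigr => q _.
  under eq_bigr do rewrite exchange_big /=.
  rewrite exchange_big /=; apply: eq_bigr => r _.
  under eq_bigr do rewrite -mulr_sumr.
  rewrite -!mulr_sumr; congr (_ * _).
  transitivity (\sum_j \sum_k B q j * B r k *
      \sum_i \sum_l (A *m B) l i * T i j k l).
    apply: eq_bigr => j _; apply: eq_bigr => k _; congr (_ * _).
    by rewrite contract_delta// mulmxV.
  under [RHS]eq_bigr do rewrite /S -(sum4E (fun i j k l =>
    B _ i * B q j * B r k * A l _ * T i j k l)).
  transitivity (\sum_i \sum_j \sum_k \sum_l \sum_p
      B p i * B q j * B r k * A l p * T i j k l); last first.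
    rewrite [RHS]exchange_big /=; apply: eq_bigr => i _.
    rewrite [RHS]exchange_big /=; apply: eq_bigr => j _.
    rewrite [RHS]exchange_big /=; apply: eq_bigr => k _.
    by rewrite [RHS]exchange_big.
  rewrite [RHS]exchange_big /=; apply: eq_bigr => j _.
  rewrite [RHS]exchange_big /=; apply: eq_bigr => k _.
  rewrite mulr_sumr; apply: eq_bigr => i _.
  rewrite mulr_sumr; apply: eq_bigr => l _.
  by rewrite mxE mulr_suml mulr_sumr; apply: eq_bigr => p _; ring.
(* Origin of n^3: each of the n^3 terms is at most [quad_form h v * N], since a coordinate of [w] is
   bounded by the length of [v] and a component [S p] by the norm. *)
apply: (@le_trans _ _ (\sum_(p < n) \sum_(q < n) \sum_(r < n) quad_form h v * N)).
  apply: (le_trans (ler_norm_sum _ _ _)); apply: ler_sum => p _.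
  apply: (le_trans (ler_norm_sum _ _ _)); apply: ler_sum => q _.
  apply: (le_trans (ler_norm_sum _ _ _)); apply: ler_sum => r _.
  rewrite 2!normrM; apply: ler_pM => //.
  rewrite -[leRHS]sqr_sqrtr// expr2.
  by apply: ler_pM.
rewrite !sumr_const !card_ord -[leLHS]mulr_natl -[X in _ * X]mulr_natl.
by rewrite -[X in _ * (_ * X)]mulr_natl !exprS expr0 !mulrA mulr1.
Qed.

Lemma mx_norm_ler (R : realType) m n (A : 'M[R]_(m, n)) (e : R) : 0 <= e ->
  (forall i j, `|A i j| <= e) -> `|A| <= e.
Proof.
by move=> e0 Ae; rewrite [leLHS]mx_normrE; apply: bigmax_le => // -[i j] _ /=.
Qed.

Lemma ler_mx_norm (R : realType) m n (A : 'M[R]_(m, n)) i j : `|A i j| <= `|A|.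
Proof. by rewrite [leRHS]mx_normrE; exact: (le_bigmax _ _ (i, j)). Qed.

(** The coordinates of [v] in an orthonormal frame are bounded by the square root of the form, and
    [v] is recovered from them by the fixed matrix [B]. *)
Lemma posdef_coercive (R : realType) n (h : 'M[R]_n) : posdef h ->
  exists2 c : R, 0 < c & forall v, c * `|v| ^+ 2 <= quad_form h v.
Proof.
case/cholesky => A Au ->.
set B := invmx A; pose b := 1 + \sum_i \sum_j `|B i j|.
have b_gt0 : 0 < b.
  by rewrite ltr_wpDr// sumr_ge0// => i _; rewrite sumr_ge0.
exists (b ^- 2); first by rewrite invr_gt0 exprn_gt0.
move=> v; rewrite quad_form_gram; set w := v *m A; set q := \sum_i _.
have q_ge0 : 0 <= q by apply: sumr_ge0 => x _; exact: sqr_ge0.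
have w_le i : `|w 0 i| <= Num.sqrt q.
  rewrite -sqrtr_sqr ler_sqrt//.
  by rewrite /q (bigD1 i)//= lerDl; apply: sumr_ge0 => x _; exact: sqr_ge0.
rewrite mulrC ler_pdivrMr ?exprn_gt0// mulrC -[q in leRHS]sqr_sqrtr// -exprMn.
have bq_ge0 : 0 <= b * Num.sqrt q by rewrite mulr_ge0// ltW.
rewrite ler_pXn2r ?nnegrE//; apply: mx_norm_ler => //.
move=> i j; rewrite ord1 -[v](mulmxK Au) mxE.
apply: (le_trans (ler_norm_sum _ _ _)).
apply: (@le_trans _ _ (\sum_k Num.sqrt q * `|B k j|)).
  by apply: ler_sum => k _; rewrite normrM; apply: ler_wpM2r.
rewrite -mulr_sumr mulrC; apply: ler_wpM2r => //.
rewrite /b -[leLHS]add0r; apply: lerD => //.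
by apply: ler_sum => k _; rewrite (bigD1 j)//= lerDl sumr_ge0.
Qed.

(** * C^k functions and the chain rule *)

Section derive_lines.
Context {R : realType} {V : normedModType R}.
Implicit Types (f : V -> R) (x y v : V).

Lemma is_derive_line f y v (s : R) : derivable f (s *: v + y) v ->
  is_derive s 1 (fun u : R => f (u *: v + y)) ('D_v f (s *: v + y)).
Proof.
move=> df.
have E : (fun h : R => h^-1 *: (f ((h *: 1 + s) *: v + y) - f (s *: v + y)))
   = (fun h : R => h^-1 *: (f (h *: v + (s *: v + y)) - f (s *: v + y))).
  apply/funext => h; congr (_ *: (f _ - _)).
  by rewrite scalerDl addrA /GRing.scale /= mulr1.
by split; [rewrite /derivable E|rewrite /derive E].
Qed.

Lemma MVT_line f y v (c : R) :
  (forall s : R, `|s| <= `|c| -> derivable f (s *: v + y) v) ->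
  exists2 s : R, `|s| <= `|c| &
    f (c *: v + y) - f y = c * 'D_v f (s *: v + y).
Proof.
move=> df; pose F := fun u : R => f (u *: v + y).
pose dF := fun u : R => 'D_v f (u *: v + y).
have dFE (s : R) : `|s| <= `|c| -> is_derive s 1 F (dF s).
  by move=> sc; apply: is_derive_line; exact: df.
have F0 : F 0 = f y by rewrite /F scale0r add0r.
have cF a b : (forall s, s \in `[a, b] -> `|s| <= `|c|) ->
    {within `[a, b], continuous F}.
  move=> ab; apply: derivable_within_continuous => s sab.
  by have [] := dFE s (ab _ sab).
have [c0|c0] := leP 0 c.
  have sc s : s \in `[0, c] -> `|s| <= `|c|.
    by rewrite in_itv /= => /andP[s0 sc]; rewrite !ger0_norm.
  have [||s s0c] := @MVT_segment _ F dF 0 c c0.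
  - by move=> s /subset_itv_oo_cc/sc/dFE.
  - exact: cF.
  by rewrite F0 => E; exists s; [exact: sc|rewrite E subr0 mulrC].
have sc s : s \in `[c, 0] -> `|s| <= `|c|.
  rewrite in_itv /= => /andP[cs s0].
  by rewrite !ler0_norm ?lerN2//; exact: ltW.
have [||s s0c] := @MVT_segment _ F dF c 0 (ltW c0).
- by move=> s /subset_itv_oo_cc/sc/dFE.
- exact: cF.
rewrite F0 sub0r => E; exists s; first exact: sc.
by rewrite -opprB [X in - X]E mulrN opprK mulrC.
Qed.

(* Moving along one direction at a time, the mean value theorem controls the
   error of the linear approximation by the variation of the derivatives. *)
Lemma increment_le (I : Type) (l : seq I) (v : I -> V) (c : I -> R) f x
    (r e : R) :
  (forall y i, `|y - x| < r ->
    derivable f y (v i) /\ `|'D_(v i) f y - 'D_(v i) f x| <= e) ->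
  \sum_(i <- l) `|c i *: v i| < r ->
  `|f (\sum_(i <- l) c i *: v i + x) - f x - \sum_(i <- l) c i * 'D_(v i) f x|
    <= e * \sum_(i <- l) `|c i|.
Proof.
move=> df; elim: l => [|i l IHl].
  by rewrite !big_nil add0r mulr0 !subrr normr0.
rewrite !big_cons => lr; pose S := \sum_(j <- l) c j *: v j; rewrite -/S in IHl *.
have lr' : \sum_(j <- l) `|c j *: v j| < r.
  by apply: le_lt_trans lr; rewrite lerDr.
have near s : `|s| <= `|c i| -> `|s *: v i + (S + x) - x| < r.
  move=> sc; rewrite addrA addrK; apply: le_lt_trans lr.
  apply: (le_trans (ler_normD _ _)); apply: lerD; last exact: ler_norm_sum.
  by rewrite !normrZ ler_wpM2r.
have [s sc sE] := @MVT_line f (S + x) (v i) (c i)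
  (fun s sc => (df _ i (near s sc)).1).
rewrite -[_ + S + x]addrA.
have -> : f (c i *: v i + (S + x)) - f x -
    (c i * 'D_(v i) f x + \sum_(j <- l) c j * 'D_(v j) f x) =
    c i * ('D_(v i) f (s *: v i + (S + x)) - 'D_(v i) f x) +
    (f (S + x) - f x - \sum_(j <- l) c j * 'D_(v j) f x).
  by rewrite mulrBr -sE; ring.
apply: (le_trans (ler_normD _ _)); rewrite [leRHS]mulrDr; apply: lerD; last exact: IHl.
by rewrite normrM mulrC ler_wpM2r//; exact: (df _ i (near s sc)).2.
Qed.

End derive_lines.

Section Ck_theory.
Context {R : realType} {V : normedModType R}.

Lemma Ck_continuous (W : normedModType R) k A (f : V -> W) x :
  Ck k A f -> A x -> {for x, continuous f}.
Proof. by case: k => [|k] [h _] Ax; exact: h. Qed.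

Lemma Ck_succ (W : normedModType R) k A (f : V -> W) : Ck k.+1 A f <->
  [/\ forall x, A x -> {for x, continuous f},
      forall x v, A x -> derivable f x v
    & forall v, Ck k A ('D_v f)].
Proof. by split=> [[? []]|[]]. Qed.

Lemma CkS (W : normedModType R) k A (f : V -> W) : Ck k.+1 A f -> Ck k A f.
Proof.
elim: k f => [|k IHk] f [fc [fd fD]]; split=> //; split=> // v.
exact/IHk/fD.
Qed.

Lemma CkW (W : normedModType R) k A B (f : V -> W) :
  B `<=` A -> Ck k A f -> Ck k B f.
Proof.
move=> BA; elim: k f => [|k IHk] f [fc].
  by move=> _; split=> // x /BA; exact: fc.
move=> [fd fD]; apply/Ck_succ; split=> [x /BA|x v /BA/fd//|v]; first exact: fc.
exact/IHk/fD.
Qed.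

Lemma Ck_eq (W : normedModType R) k A (f g : V -> W) : open A ->
  (forall x, A x -> f x = g x) -> Ck k A f -> Ck k A g.
Proof.
move=> oA; elim: k f g => [|k IHk] f g fg [fc].
  move=> _; split=> // x Ax; have := fc _ Ax.
  rewrite /prop_for /continuous_at -(fg x Ax); apply: cvg_trans.
  apply: near_eq_cvg; near=> y; apply: fg.
  by near: y; exact: open_nbhs_nbhs.
move=> [fd fD]; split.
  move=> x Ax; have := fc _ Ax.
  rewrite /prop_for /continuous_at -(fg x Ax); apply: cvg_trans.
  apply: near_eq_cvg; near=> y; apply: fg.
  by near: y; exact: open_nbhs_nbhs.
have fgn x : A x -> \near x, f x = g x.
  move=> Ax; near=> y; apply: fg.
  by near: y; exact: open_nbhs_nbhs.
split=> [x v Ax|v]; first exact: (near_eq_derivable (fgn _ Ax) (fd _ _ Ax)).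
apply: IHk (fD v) => x Ax.
exact: near_eq_derive (fgn _ Ax).
Unshelve. all: by end_near. Qed.

Lemma Ck_cst (W : normedModType R) k A (c : W) : Ck k A (fun _ : V => c).
Proof.
elim: k c => [|k IHk] c.
  by split=> // x _; exact: cvg_cst.
apply/Ck_succ; split=> [x _|x v _|v]; first exact: cvg_cst.
  exact: derivable_cst.
have -> : 'D_v (fun=> c : W) = fun=> 0 :> W.
  by apply/funext => x; rewrite derive_cst.
exact: IHk.
Qed.

Lemma CkD k A (f g : V -> R) : open A -> Ck k A f -> Ck k A g ->
  Ck k A (fun x => f x + g x).
Proof.
move=> oA; elim: k f g => [|k IHk] f g.
  move=> [fc _] [gc _].
  by split=> // x Ax; apply: cvgD; [exact: fc|exact: gc].
move=> /Ck_succ[fc fd1 fd2] /Ck_succ[gc gd1 gd2]; apply/Ck_succ.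
split=> [x Ax|x v Ax|v]; first by apply: cvgD; [exact: fc|exact: gc].
  by apply: derivableD; [exact: fd1|exact: gd1].
apply: (@Ck_eq _ k _ (fun x => 'D_v f x + 'D_v g x)) => //.
  by move=> x Ax; rewrite -deriveD//; [exact: fd1|exact: gd1].
exact: IHk.
Qed.

Lemma CkM k A (f g : V -> R) : open A -> Ck k A f -> Ck k A g ->
  Ck k A (fun x => f x * g x).
Proof.
move=> oA; elim: k f g => [|k IHk] f g Cf Cg.
  have [[fc _] [gc _]] := (Cf, Cg).
  by split=> // x Ax; apply: cvgM; [exact: fc|exact: gc].
have [[fc fd1 fd2] [gc gd1 gd2]] := ((Ck_succ _ _ _).1 Cf, (Ck_succ _ _ _).1 Cg).
apply/Ck_succ; split=> [x Ax|x v Ax|v]; first by apply: cvgM; [exact: fc|exact: gc].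
  by apply: derivableM; [exact: fd1|exact: gd1].
apply: (@Ck_eq _ k _ (fun x => f x * 'D_v g x + g x * 'D_v f x)) => //.
  by move=> x Ax; rewrite [RHS]deriveM//; [exact: fd1|exact: gd1].
exact: (CkD oA (IHk _ _ (CkS Cf) (gd2 v)) (IHk _ _ (CkS Cg) (fd2 v))).
Qed.

Lemma CkV k A (f : V -> R) : open A -> (forall x, A x -> f x != 0) ->
  Ck k A f -> Ck k A (fun x => (f x)^-1).
Proof.
move=> oA f0; elim: k => [|k IHk] Cf.
  by have [fc _] := Cf; split=> // x Ax; apply: cvgV; [exact: f0|exact: fc].
have [fc fd1 fd2] := (Ck_succ _ _ _).1 Cf.
apply/Ck_succ; split=> [x Ax|x v Ax|v].
- by apply: cvgV; [exact: f0|exact: fc].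
- by apply: derivableV; [exact: f0|exact: fd1].
apply: (@Ck_eq _ k _ (fun x => (-1 * ((f x)^-1 * (f x)^-1)) * 'D_v f x)) => //.
  move=> x Ax; rewrite [RHS]deriveV//; [|exact: f0|exact: fd1].
  by rewrite -exprVn expr2 mulN1r.
have Ci := IHk (CkS Cf).
exact: (CkM oA (CkM oA (Ck_cst _ _ (-1 : R)) (CkM oA Ci Ci)) (fd2 v)).
Qed.

End Ck_theory.

Lemma cvg_sumr (R : realType) T (F : set_system T) {FF : Filter F} (I : Type)
    (s : seq I) (f : I -> T -> R) (a : I -> R) :
  (forall i, f i x @[x --> F] --> a i) ->
  \sum_(i <- s) f i x @[x --> F] --> \sum_(i <- s) a i.
Proof.
move=> fa; elim: s => [|i s IHs].
  by under eq_fun do rewrite big_nil; rewrite big_nil; exact: cvg_cst.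
by under eq_fun do rewrite big_cons; rewrite big_cons; exact: cvgD.
Qed.

Section chain_rule.
Context {R : realType} {n : nat}.
Implicit Types (zeta : R^o -> 'rV[R]_n) (A : set 'rV[R]_n) (u : R).

(** [Ck 1] speaks of directional derivatives only, so total differentiability of [f] is not at hand.
    The increment of [f] along the curve is instead decomposed along the coordinate axes by
    [increment_le], with the difference quotients [q h i] as coefficients. *)
Lemma C1_comp_curve (f : 'rV[R]_n -> R) zeta A u : open A -> Ck 1 A f ->
  A (zeta u) -> derivable zeta u 1 ->
  is_derive u 1 (fun t => f (zeta t))
    (\sum_i 'D_1 zeta u 0 i * partial i f (zeta u)).
Proof.
move=> oA [fc [fd fD]] Au dz.
set x := zeta u; set L := \sum_i _.
pose q (h : R) i : R := h^-1 * (zeta (h + u) 0 i - zeta u 0 i).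
have qc i : q h i @[h --> 0^'] --> 'D_1 zeta u 0 i.
  have dzi : derivable (fun t => zeta t 0 i) u 1 by exact: (derivable_mxP _ _ _).1.
  rewrite derive_mx// mxE /q.
  have := dzi; rewrite /derivable -/(derive (fun t => zeta t 0 i) u 1).
  apply: cvg_trans; apply: near_eq_cvg; near=> h.
  by rewrite /GRing.scale /= mulr1.
have qL : (\sum_i q h i * partial i f x) @[h --> 0^'] --> L.
  apply: (@cvg_sumr R _ _ _ _ _ (fun i h => q h i * partial i f x)) => i.
  by apply: cvgMl; exact: qc.
suff qQ : (h^-1 * (f (zeta (h + u)) - f x) - \sum_i q h i * partial i f x)
    @[h --> 0^'] --> (0 : R).
  have QL : (h^-1 *: (f (zeta (h *: 1 + u)) - f x)) @[h --> 0^'] --> L.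
    rewrite -[L]add0r; apply: cvg_trans (cvgD qQ qL); apply: near_eq_cvg.
    by near=> h; rewrite /= subrK /GRing.scale /= mulr1.
  split; first by apply/cvg_ex; exists L.
  exact: cvg_lim.
(* Near 0 the difference quotients have l^1-norm below [K]. Partial derivatives varying by at most
   [e / K] thus leave an error of at most [e * |h|] in the increment. *)
pose K := 1 + \sum_i `|'D_1 zeta u 0 i|.
have K_gt0 : 0 < K by rewrite ltr_wpDr// sumr_ge0.
have qK : \forall h \near (0 : R)^', \sum_i `|q h i| < K.
  have : (\sum_i `|q h i|) @[h --> 0^'] --> \sum_i `|'D_1 zeta u 0 i|.
    apply: (@cvg_sumr R _ _ _ _ _ (fun i h => `|q h i|)) => i.
    by apply: cvg_norm; exact: qc.
  by move/cvgr_lt; apply; rewrite /K ltrDr.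
apply/cvgr0Pnorm_le => e e0.
have [r /= r0 rP] : exists2 r : R, 0 < r & forall y i, `|y - x| < r ->
    derivable f y (delta_mx 0 i) /\ `|partial i f y - partial i f x| <= e / K.
  pose P (i : 'I_n) y := derivable f y (delta_mx 0 i) /\
    `|partial i f y - partial i f x| <= e / K.
  have : \forall y \near x, forall i, P i y.
    suff Pn i : \forall y \near x, P i y.
      exact: (@filter_forall _ _ P (nbhs x) _ Pn).
    have Dc : {for x, continuous (partial i f)}.
      by case: (fD (delta_mx 0 i)) => + _; apply.
    near=> y; split.
      by apply: fd; near: y; exact: open_nbhs_nbhs.
    rewrite distrC; near: y; move/cvgrPdist_le : Dc; apply.
    by rewrite divr_gt0.
  move=> /nbhs_ballP[r /= r0 rP]; exists r => // y i yr; apply: rP.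
  by rewrite -ball_normE /ball_ /= distrC.
have qr : \forall h \near (0 : R)^', `|h| * K < r.
  near=> h; rewrite -ltr_pdivlMr//; near: h.
  by apply: dnbhs0_lt; rewrite divr_gt0.
near=> h.
have h0 : h != 0 by near: h; exact: nbhs_dnbhs_neq.
have qhK : \sum_i `|q h i| < K by near: h.
have hq i : zeta (h + u) 0 i - x 0 i = h * q h i by rewrite /q mulVKf.
have zE : zeta (h + u) = \sum_i (h * q h i) *: delta_mx 0 i + x.
  rewrite -[LHS](subrK x) [X in X + _]row_sum_delta; congr (_ + _).
  by apply: eq_bigr => i _; rewrite !mxE hq.
have := @increment_le R _ _ (index_enum 'I_n) (fun i => delta_mx 0 i : 'rV[R]_n)
  (fun i => h * q h i) f x r (e / K) rP.
rewrite -zE => /(_ _)/wrap[].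
  have hr : `|h| * K < r by near: h.
  apply: le_lt_trans hr.
  apply: (@le_trans _ _ (`|h| * \sum_i `|q h i|)); last by rewrite ler_wpM2l// ltW.
  rewrite mulr_sumr; apply: ler_sum => i _; rewrite normrZ normrM.
  rewrite -[leRHS]mulr1; apply: ler_wpM2l; first by rewrite mulr_ge0.
  apply: mx_norm_ler => // a b; rewrite mxE.
  by case: (_ && _); rewrite /= ?normr1 ?normr0.
move=> Hle.
have Es : \sum_i h * q h i * 'D_(delta_mx 0 i) f x =
    h * \sum_i q h i * partial i f x.
  by rewrite mulr_sumr; apply: eq_bigr => i _; rewrite mulrA.
have En : \sum_i `|h * q h i| = `|h| * \sum_i `|q h i|.
  by rewrite mulr_sumr; apply: eq_bigr => i _; rewrite normrM.
rewrite Es En in Hle.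
have -> : h^-1 * (f (zeta (h + u)) - f x) - \sum_i q h i * partial i f x =
    h^-1 * (f (zeta (h + u)) - f x - h * \sum_i q h i * partial i f x).
  by rewrite [RHS]mulrBr mulKf.
rewrite normrM normfV ler_pdivrMl ?normr_gt0//; apply: (le_trans Hle).
rewrite mulrCA ler_wpM2l//.
by rewrite mulrAC ler_pdivrMr// ler_wpM2l// ?ltW.
Unshelve. all: by end_near. Qed.

Lemma C1_comp_curve_mx m (f : 'rV[R]_n -> 'rV[R]_m) zeta A u : open A ->
  Ck 1 A f -> A (zeta u) -> derivable zeta u 1 ->
  is_derive u 1 (fun t => f (zeta t))
    ('D_1 zeta u *m \matrix_(i, k) partial i (fun y => f y 0 k) (zeta u)).
Proof.
move=> oA [fc [fd fD]] Au dz.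
have C1 k : Ck 1 A (fun y => f y 0 k).
  split=> [y Ay|].
    apply: (@continuous_comp _ _ _ f (fun z => z 0 k)); first exact: fc.
    exact: matrix_normedtype.coord_continuous.
  split=> [y v Ay|v].
    exact: (derivable_mxP _ _ _).1 (fd _ _ Ay) _ _.
  apply: (@Ck_eq _ _ _ 0 _ (fun y => 'D_v f y 0 k)) => //.
    by move=> y Ay; rewrite derive_mx ?mxE//; exact: fd.
  have [Dc _] := fD v; split=> // y Ay.
  apply: (@continuous_comp _ _ _ ('D_v f) (fun z => z 0 k)); first exact: Dc.
  exact: matrix_normedtype.coord_continuous.
have D k := C1_comp_curve oA (C1 k) Au dz.
have df : derivable (fun t => f (zeta t)) u 1.
  by apply/derivable_mxP => i k; rewrite ord1; have [] := D k.
split=> //; rewrite derive_mx//; apply/matrixP => i k; rewrite ord1 !mxE.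
have [_ ->] := D k.
by apply: eq_bigr => j _; rewrite mxE.
Qed.

End chain_rule.

Section monotonicity.
Context {R : realType}.

(** Induction on the exceptional points: one that lies inside the interval cuts it in two, any other
    is dropped. Continuity glues the pieces. *)
Lemma le_derive_off_finite (F : R -> R) (u v : R) (s : seq R) : u <= v ->
  {within `[u, v], continuous F} ->
  (forall x, u < x < v -> x \notin s -> derivable F x 1 /\ 0 <= 'D_1 F x) ->
  F u <= F v.
Proof.
elim: s u v => [|c s IHs] u v uv cF dF.
  apply: (@ger0_derive1_le_cc _ F u v); rewrite ?in_itv /= ?lexx ?uv//.
  - by move=> x; rewrite in_itv /= => xuv; have [] := dF _ xuv isT.
  - by move=> x; rewrite in_itv /= derive1E => xuv; have [] := dF _ xuv isT.
have [/andP[uc cv]|cuv] := boolP (u < c < v); last first.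
  apply: IHs => // x xuv xs; apply: dF => //; rewrite inE negb_or xs andbT.
  by apply: contraNneq cuv => <-.
apply: (@le_trans _ _ (F c)).
  apply: IHs => [||x /andP[ux xc] xs]; first exact: ltW.
    apply: continuous_subspaceW cF; apply/subset_itvl.
    by rewrite bnd_simp ltW.
  apply: dF; first by rewrite ux (lt_trans xc).
  by rewrite inE negb_or xs andbT lt_eqF.
apply: IHs => [||x /andP[cx xv] xs]; first exact: ltW.
  apply: continuous_subspaceW cF; apply/subset_itvr.
  by rewrite bnd_simp ltW.
apply: dF; first by rewrite xv (lt_trans uc).
by rewrite inE negb_or xs andbT gt_eqF.
Qed.

End monotonicity.

(** * The speed of a curve in coordinates *)

Section curves.
Context {R : realType} {n : nat} (M : manifold R n).
Implicit Types (gamma : R^o -> M) (h : field2 M).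

(** The transition maps are [Ck] on this set, and the chain rule asks for an open one. Near
    [coord a x] the continuity of [param a] keeps the point in [dom b]. *)
Lemma open_overlap (a b : chart M) : open (coord a @` (dom a `&` dom b)).
Proof.
rewrite openE => _ [x [ax bx] <-].
have za : (coord a @` dom a) (coord a x) by exists x.
have pb : \forall z \near coord a x, dom b (param a z).
  apply: (param_continuous za); rewrite coordK//.
  by apply: open_nbhs_nbhs; split => //; exact: dom_open.
have im : \forall z \near coord a x, (coord a @` dom a) z.
  by apply: open_nbhs_nbhs; split => //; exact: image_open.
rewrite /interior; near=> z.
have [y ay yz] : (coord a @` dom a) z by near: z.
exists y => //; split => //; rewrite -(coordK ay) yz.
by near: z.
Unshelve. all: by end_near. Qed.

Definition C1_chart gamma (a : chart M) (U : set R^o) (F : R^o -> 'rV[R]_n) :=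
  [/\ open U, Ck 1 U F & forall w, U w -> dom a (gamma w) /\ F w = coord a (gamma w)].

Definition C1_at gamma (u : R) :=
  exists a U F, C1_chart gamma a U F /\ U u.

Lemma C1_chart_deriv gamma a U F b w : C1_chart gamma a U F -> U w ->
  dom b (gamma w) ->
  is_derive (w : R^o) 1 (coord b \o gamma) ('D_1 F w *m jacobian a b (coord a (gamma w))).
Proof.
move=> [oU CF UF] Uw bw; have [aw Fw] := UF _ Uw.
have fC : Ck 1 (coord a @` (dom a `&` dom b)) (coord b \o param a).
  exact: transition_smooth.
have Fim : (coord a @` (dom a `&` dom b)) (F w) by exists (gamma w).
have [_ Fd _] := (Ck_succ _ _ _).1 CF.
have := C1_comp_curve_mx (@open_overlap a b) fC Fim (Fd _ _ Uw).
rewrite Fw => D.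
apply: (near_eq_is_derive _ D).
near=> t; have [at_ Ft] : dom a (gamma t) /\ F t = coord a (gamma t).
  by apply: UF; near: t; exact: open_nbhs_nbhs.
by rewrite /= Ft coordK.
Unshelve. all: by end_near. Qed.

(** [speed] reads the velocity in a chart chosen at each point, which may jump along the curve. The
    tensor law and the chain rule replace it by a single chart around [w], and only then does
    continuity of the speed make sense as a coordinate statement. *)
Lemma speedE h gamma a U F w : tensor_law h -> C1_chart gamma a U F -> U w ->
  speed h gamma w = Num.sqrt (quad_form (h a (F w)) ('D_1 F w)).
Proof.
move=> hT C1 Uw; have [_ _ UF] := C1; have [aw Fw] := UF _ Uw.
have bw : dom (chart_at (gamma w)) (gamma w) by rewrite /chart_at; case: cid.
rewrite /speed; congr Num.sqrt.
have [_ ->] := C1_chart_deriv C1 Uw bw.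
by rewrite quad_form_mulmx Fw -hT.
Qed.

Lemma quad_speed_continuous h a (U : set R^o) F (w : R^o) : is_metric h ->
  Ck 1 U F -> U w -> (coord a @` dom a) (F w) ->
  {for w, continuous (fun t : R^o => Num.sqrt (quad_form (h a (F t)) ('D_1 F t)))}.
Proof.
move=> [hC _ _ _] /Ck_succ[Fc _ FD] Uw Fim.
have Dc : {for w, continuous ('D_1 F)} by have [+ _] := FD 1; apply.
apply: (@continuous_comp _ _ _ (fun t => quad_form (h a (F t)) ('D_1 F t)) Num.sqrt);
  last exact: sqrt_continuous.
rewrite /prop_for /continuous_at quad_formE.
have -> : (fun t => quad_form (h a (F t)) ('D_1 F t)) = fun t =>
    \sum_i \sum_j 'D_1 F t 0 i * 'D_1 F t 0 j * h a (F t) i j.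
  by apply/funext => t; rewrite quad_formE.
apply: (@cvg_sumr R _ _ _ _ _ (fun i t => \sum_j _)) => i.
apply: (@cvg_sumr R _ _ _ _ _ (fun j t => _ * h a (F t) i j)) => j.
have vc k : {for w, continuous (fun t => 'D_1 F t 0 k)}.
  apply: (@continuous_comp _ _ _ ('D_1 F) (fun z => z 0 k)) => //.
  exact: matrix_normedtype.coord_continuous.
have hc : {for w, continuous (fun t => h a (F t) i j)}.
  apply: (@continuous_comp _ _ _ F (fun z => h a z i j)); first exact: Fc.
  by have [+ _] := hC a i j 0%N; apply.
by apply: cvgM; [apply: cvgM; exact: vc|exact: hc].
Qed.

Lemma speed_continuous h gamma w : is_metric h -> C1_at gamma w ->
  {for w, continuous (speed h gamma)}.
Proof.
move=> hm [a [U [F [C1 Uw]]]]; have [_ _ _ hT] := hm.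
have Un : nbhs (w : R^o) U by apply: open_nbhs_nbhs; split => //; case: C1.
have [oU CF UF] := C1; have [aw Fw] := UF _ Uw.
have := @quad_speed_continuous h a U F w hm CF Uw.
move=> /(_ _)/wrap[]; first by rewrite Fw; exists (gamma w).
rewrite /prop_for /continuous_at -(speedE hT C1 Uw).
apply: cvg_trans; apply: near_eq_cvg; near=> t.
by rewrite (speedE hT C1)//; near: t; exact: Un.
Unshelve. all: by end_near. Qed.

Lemma speed_ge0 h gamma w : 0 <= speed h gamma w.
Proof. exact: sqrtr_ge0. Qed.

Lemma speed_near h gamma gamma' (w : R^o) : {near w, gamma =1 gamma'} ->
  speed h gamma w = speed h gamma' w.
Proof.
move=> E; have Ew := nbhs_singleton E.
rewrite /speed Ew; congr (Num.sqrt (quad_form _ _)).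
by apply: near_eq_derive; near=> t; rewrite /=; congr coord; near: t.
Unshelve. all: by end_near. Qed.

(** * Affine reparametrisation of curves *)

Definition affine (al be : R) (x : R^o) : R^o := al * x + be.

Lemma continuous_affine al be : continuous (affine al be).
Proof.
move=> x; apply: cvgD; last exact: cvg_cst.
by apply: cvgMr; exact: cvg_id.
Qed.

Lemma Ck1_affine (W : normedModType R) U (F : R^o -> W) al be : Ck 1 U F ->
  Ck 1 (affine al be @^-1` U) (F \o affine al be) /\
  forall x v, 'D_v (F \o affine al be) x = 'D_(al * v) F (affine al be x).
Proof.
move=> /Ck_succ[Fc Fd FD].
have E (x v : R^o) : (fun e : R => e^-1 *: ((F \o affine al be) (e *: v + x) -
    (F \o affine al be) x)) =
    (fun e : R => e^-1 *: (F (e *: (al * v : R^o) + affine al be x) -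
      F (affine al be x))).
  apply/funext => e; congr (_ *: (F _ - _)).
  by rewrite /affine /GRing.scale /=; ring.
have DE x v : 'D_v (F \o affine al be) x = 'D_(al * v) F (affine al be x).
  by rewrite /derive E.
split=> //; apply/Ck_succ; split=> [x Ux|x v Ux|v].
- by apply: continuous_comp; [exact: continuous_affine|exact: Fc].
- by rewrite /derivable E; exact: Fd.
- split=> // x Ux.
  have -> : 'D_v (F \o affine al be) = 'D_(al * v) F \o affine al be.
    by apply/funext => y; rewrite DE.
  apply: continuous_comp; first exact: continuous_affine.
  by have [+ _] := FD (al * v); apply.
Qed.

Lemma C1_chart_affine gamma a U F al be : C1_chart gamma a U F ->
  C1_chart (gamma \o affine al be) a (affine al be @^-1` U) (F \o affine al be).
Proof.
move=> [oU CF UF]; split.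
- by apply: open_comp => // x _; exact: continuous_affine.
- by have [] := Ck1_affine al be CF.
- by move=> w /UF.
Qed.

Lemma speed_affine h gamma al be x : tensor_law h ->
  C1_at gamma (affine al be x) ->
  speed h (gamma \o affine al be) x = `|al| * speed h gamma (affine al be x).
Proof.
move=> hT [a [U [F [C1 Ux]]]]; have [_ CF _] := C1.
rewrite (speedE hT (C1_chart_affine al be C1) Ux) (speedE hT C1 Ux).
have [_ ->] := Ck1_affine al be CF.
have [_ Fd _] := (Ck_succ _ _ _).1 CF.
have dF : differentiable F (affine al be x).
  by apply/derivable1_diffP; exact: Fd.
have -> : 'D_(al * 1) F (affine al be x) = al *: 'D_1 F (affine al be x).
  by rewrite !deriveE// -linearZ.
rewrite /quad_form linearZ /= -!scalemxAl -scalemxAr scalerA mxE.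
by rewrite -expr2 sqrtrM ?sqr_ge0// sqrtr_sqr.
Qed.

(** Generated by concatenation rather than by a list of break points, so that restriction,
    reparametrisation and continuity go by induction. [pc1_partition] relates it to the partitions
    of [path_from_to]. *)
Inductive pc1 gamma : R -> R -> Prop :=
| pc1_segment u v : u < v -> C1_on_segment gamma u v -> pc1 gamma u v
| pc1_trans u w v : pc1 gamma u w -> pc1 gamma w v -> pc1 gamma u v.

Lemma pc1_lt gamma u v : pc1 gamma u v -> u < v.
Proof. by elim=> // ? ? ? _ uw _; exact: lt_trans. Qed.

Lemma C1_on_segmentW gamma gamma' u v u' v' : C1_on_segment gamma u v ->
  u <= u' -> v' <= v -> (forall x, u' <= x <= v' -> gamma x = gamma' x) ->
  C1_on_segment gamma' u' v'.
Proof.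
move=> C1 uu vv E w /andP[uw wv].
have sub x : u' <= x <= v' -> u <= x <= v.
  by move=> /andP[ux xv]; rewrite (le_trans uu) ?(le_trans xv).
have [|a [U [oU Uw Ud UC]]] := C1 w; first by rewrite sub// uw.
exists a, U; split => // [x Ux xuv|x [Ux xuv]].
  by rewrite -E//; apply: Ud => //; exact: sub.
have [|V [F [oV Vx CF VF]]] := UC x; first by split => //; exact: sub.
exists V, F; split => // y Vy [Uy yuv].
by rewrite VF//=; [rewrite E|split => //; exact: sub].
Qed.

Lemma C1_on_segment_chart gamma u v w : C1_on_segment gamma u v -> u <= w <= v ->
  exists a U F, [/\ open U, U w, Ck 1 U F &
    forall x : R^o, U x -> u <= x <= v -> dom a (gamma x) /\ F x = coord a (gamma x)].
Proof.
move=> C1 wuv; have [a [U [oU Uw Ud UC]]] := C1 w wuv.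
have [|V [F [oV Vw CF VF]]] := UC w; first by [].
exists a, (U `&` V), F; split=> //.
- exact: openI.
- by apply: CkW CF => x [].
- by move=> x [Ux Vx] xuv; split; [exact: Ud|exact: VF].
Qed.

Lemma C1_on_segment_interior gamma u v w : C1_on_segment gamma u v -> u < w < v ->
  C1_at gamma w.
Proof.
move=> C1 /andP[uw wv].
have [|a [U [F [oU Uw CF UF]]]] := C1_on_segment_chart (w := w) C1; first by rewrite !ltW.
exists a, (U `&` [set` `]u, v[]), F; split; last first.
  by split => //=; rewrite in_itv /= uw.
split; first by apply: openI => //; exact: interval_open.
- by apply: CkW CF => x [].
- move=> x [Ux]; rewrite /= in_itv /= => /andP[ux xv].
  by apply: UF => //; rewrite !ltW.
Qed.

Lemma pc1_C1_at gamma u v : pc1 gamma u v ->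
  exists s : seq R, forall x, u < x < v -> x \notin s -> C1_at gamma x.
Proof.
elim=> [{}u {}v uv C1|{}u w {}v _ [s sP] _ [t tP]].
  by exists [::] => x xuv _; exact: C1_on_segment_interior C1 xuv.
exists (w :: s ++ t) => x /andP[ux xv]; rewrite inE mem_cat !negb_or.
move=> /and3P[xw xs xt]; have [xw'|wx|xw'] := ltgtP x w.
- by apply: sP => //; rewrite ux.
- by apply: tP => //; rewrite wx.
- by rewrite xw' eqxx in xw.
Qed.

(** This is what makes the speed integrable. Continuity at interior points is not enough, since the
    speed could blow up towards a break point; the C^1 extensions beyond the ends of each segment
    prevent it. *)
Lemma pc1_speed_bounded h gamma u v : is_metric h -> pc1 gamma u v ->
  exists (K : R) (s : seq R), forall x, u < x < v -> x \notin s -> speed h gamma x <= K.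
Proof.
move=> hm; elim=> [{}u {}v uv C1|{}u w {}v _ [K [s sP]] _ [L [t tP]]]; last first.
  exists (Num.max K L), (w :: s ++ t) => x /andP[ux xv].
  rewrite inE mem_cat !negb_or le_max.
  move=> /and3P[xw xs xt]; have [xw'|wx|xw'] := ltgtP x w.
  - by rewrite sP// ux.
  - by rewrite tP ?orbT// wx.
  - by rewrite xw' eqxx in xw.
(* Compactness in its near-covering form: if every point has a neighbourhood on which all large [K]
   are bounds, then all large [K] are bounds on the whole segment. *)
suff : \forall K \near +oo, `[u, v] `<=` [set x | u < x < v -> speed h gamma x <= K].
  move=> [K [_ KP]]; exists (K + 1), [::] => x xuv _; apply: (KP (K + 1)) => //; rewrite ?ltrDl//.
  by move: xuv => /andP[ux xv]; rewrite /= in_itv /= !ltW.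
apply: (compact_near_coveringP _).1 (@segment_compact R u v) _ _ _ _ _.
move=> w; rewrite /= in_itv /= => wuv.
have [a [U [F [oU Uw CF UF]]]] := C1_on_segment_chart C1 wuv.
have [aw Fw] := UF _ Uw wuv; have [hC _ _ hT] := hm.
(* [phi] uses the extension [F], hence is continuous at [w] even when [w] is an end of the segment,
   where the value of the speed itself is uncontrolled. *)
pose phi (t : R) := Num.sqrt (quad_form (h a (F t)) ('D_1 F t)).
have phi_near : \forall x \near (w : R^o), phi x < phi w + 1.
  have phi_c : {for (w : R^o), continuous phi}.
    by apply: (quad_speed_continuous hm CF Uw); rewrite Fw; exists (gamma w).
  move: phi_c => /cvgr_lt; apply; rewrite ltrDl//.
exists ([set x | U x /\ phi x < phi w + 1], [set K | phi w + 1 <= K]) => /=.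
  split; last exact: (nbhs_pinfty_ge (num_real _)).
  by apply: filterI => //; exact: open_nbhs_nbhs.
move=> [x K] /= [[Ux phix] phiK] xuv; apply: le_trans phiK; apply: ltW.
suff -> : speed h gamma x = phi x by [].
have C1x : C1_chart gamma a (U `&` [set` `]u, v[]) F.
  split; first by apply: openI => //; exact: interval_open.
  - by apply: CkW CF => y [].
  - move=> y [Uy]; rewrite /= in_itv /= => /andP[uy yv].
    by apply: UF => //; rewrite !ltW.
by rewrite (speedE hT C1x)//; split => //; rewrite /= in_itv.
Qed.

End curves.

(** * Arc length *)

Section piecewise.
Context {R : realType} {n : nat} (M : manifold R n).
Implicit Types (gamma : R^o -> M) (h : field2 M).

Lemma pc1_eq gamma gamma' u v : pc1 gamma u v ->
  (forall x, u <= x <= v -> gamma x = gamma' x) -> pc1 gamma' u v.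
Proof.
elim=> [{}u {}v uv C1 E|{}u w {}v uw IHu wv IHv E].
  by apply: pc1_segment => //; exact: C1_on_segmentW C1 _ _ E.
have [u_w w_v] := (pc1_lt uw, pc1_lt wv).
apply: (@pc1_trans _ _ _ _ _ w); [apply: IHu|apply: IHv] => x /andP[ux xv].
  by apply: E; rewrite ux (le_trans xv)// ltW.
by apply: E; rewrite xv (le_trans _ ux)// ltW.
Qed.

Lemma pc1_take gamma u v w : pc1 gamma u v -> u < w -> w <= v -> pc1 gamma u w.
Proof.
move=> uv; elim: uv w => [{}u {}v uv C1 w uw wv|{}u c {}v uc IHu cv IHv w uw wv].
  by apply: pc1_segment => //; exact: C1_on_segmentW C1 _ _ _.
have [wc|cw] := leP w c; first exact: IHu.
by apply: (@pc1_trans _ _ _ _ _ c) => //; exact: IHv.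
Qed.

Lemma C1_on_segment_affine gamma u v u' v' al be : C1_on_segment gamma u v ->
  (forall x, u' <= x <= v' -> u <= affine al be x <= v) ->
  C1_on_segment (gamma \o affine al be) u' v'.
Proof.
move=> C1 E w wuv; have [a [U [oU Uw Ud UC]]] := C1 _ (E _ wuv).
exists a, (affine al be @^-1` U); split => //.
- by apply: open_comp => // x _; exact: continuous_affine.
- by move=> x Ux /E; exact: Ud.
- move=> x [Ux xuv]; have [|V [F [oV Vx CF VF]]] := UC (affine al be x).
    by split => //; exact: E.
  exists (affine al be @^-1` V), (F \o affine al be); split.
  + by apply: open_comp => // y _; exact: continuous_affine.
  + exact: Vx.
  + by have [] := Ck1_affine al be CF.
  + by move=> y Vy [Uy yuv]; rewrite /= VF//; split => //; exact: E.
Qed.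

Lemma pc1_affine_pos gamma u v al be : 0 < al -> pc1 gamma u v ->
  pc1 (gamma \o affine al be) ((u - be) / al) ((v - be) / al).
Proof.
move=> al0; elim=> [{}u {}v uv C1|{}u w {}v _ IHu _ IHv]; last exact: pc1_trans IHu IHv.
apply: pc1_segment; first by rewrite ltr_pM2r ?invr_gt0// ltrD2r.
apply: C1_on_segment_affine C1 _ => x.
rewrite ler_pdivrMr// ler_pdivlMr// /affine => /andP[? ?].
by apply/andP; split; lra.
Qed.

Lemma pc1_rev gamma u v : pc1 gamma u v ->
  pc1 (gamma \o affine (-1) 1) (1 - v) (1 - u).
Proof.
elim=> [{}u {}v uv C1|{}u w {}v _ IHu _ IHv]; last exact: pc1_trans IHv IHu.
apply: pc1_segment; first by rewrite ltrD2l ltrN2.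
apply: C1_on_segment_affine C1 _ => x /andP[? ?]; rewrite /affine.
by apply/andP; split; lra.
Qed.

Lemma pc1_continuous gamma u v : pc1 gamma u v ->
  {within `[u, v], continuous gamma}.
Proof.
elim=> [{}u {}v uv C1|{}u w {}v uw IHu wv IHv]; last first.
  have -> : `[u, v]%classic = `[u, w] `|` `[w, v] :> set R.
    have [u_w w_v] := (pc1_lt uw, pc1_lt wv).
    apply/seteqP; split=> x /=; rewrite !in_itv /=.
      move=> /andP[ux xv]; have [xw|wx] := leP x w; first by left; rewrite ux.
      by right; rewrite xv ltW.
    move=> [/andP[ux xw]|/andP[wx xv]].
      by rewrite ux (le_trans xw)// ltW.
    by rewrite xv (le_trans _ wx)// ltW.
  by apply: withinU_continuous => //; exact: interval_closed.
apply/subspace_continuousP => x; rewrite /= in_itv /= => xuv.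
have [a [U [F [oU Ux CF UF]]]] := C1_on_segment_chart C1 xuv.
have [ax Fx] := UF _ Ux xuv.
have Fc : {for (x : R^o), continuous F} by exact: Ck_continuous CF Ux.
have pc : {for F x, continuous (param a)}.
  by apply: param_continuous; rewrite Fx; exists (gamma x).
have := continuous_comp Fc pc.
rewrite /prop_for /continuous_at /= Fx coordK// => pFc.
have : (param a (F y) @[y --> within [set` `[u, v]] (nbhs (x : R^o))] --> gamma x).
  exact: cvg_within_filter pFc.
apply: cvg_trans; apply: near_eq_cvg.
have Un : \forall y \near (x : R^o), U y by exact: open_nbhs_nbhs.
rewrite near_withinE; near=> y => /=; rewrite in_itv /= => yuv.
have Uy : U y by near: y; exact: Un.
have [ay ->] := UF _ Uy yuv.
by rewrite coordK.
Unshelve. all: by end_near. Qed.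

Lemma pc1_partition gamma u v : pc1 gamma u v <->
  u < v /\ exists2 s : seq R, itv_partition u v s & forall i, (i < size s)%N ->
    C1_on_segment gamma (nth 0 (u :: s) i) (nth 0 (u :: s) i.+1).
Proof.
split.
  elim=> [{}u {}v uv C1|{}u w {}v uw [u_w [s us sP]] wv [w_v [t wt tP]]].
    by split=> //; exists [:: v]; [exact: itv_partition1|case].
  split; first exact: lt_trans u_w w_v.
  exists (s ++ t); first exact: itv_partition_cat us wt.
  move=> i; rewrite size_cat => ist.
  have [is_|si] := ltnP i (size s).
    rewrite -cat_cons !nth_cat /= !ltnS (ltnW is_) is_; exact: sP.
  have Es : nth 0 (u :: s) (size s) = w.
    exact: itv_partition_nth_size us.
  have -> : nth 0 (u :: s ++ t) i.+1 = nth 0 (w :: t) (i - size s).+1.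
    by rewrite /= nth_cat ltnNge si.
  have -> : nth 0 (u :: s ++ t) i = nth 0 (w :: t) (i - size s).
    rewrite -cat_cons nth_cat /= ltnS; have [si'|si'] := leqP i (size s).
      have -> : i = size s by apply/eqP; rewrite eqn_leq si'.
      by rewrite subnn.
    by move: si'; case: i {ist si} => // i; rewrite ltnS => si'; rewrite subSS subSn.
  by apply: tP; rewrite ltn_subLR.
move=> [uv [s + sP]]; elim: s u uv sP => [|x s IHs] u uv sP.
  by move=> /itv_partition_nil uv'; rewrite uv' ltxx in uv.
move=> xs; have /andP[/= ux _] : path <%R u (x :: s) by case: xs.
have C1 : C1_on_segment gamma u x by exact: (sP 0%N).
have := itv_partition_cons xs; case: s IHs sP {xs} => [|y s] IHs sP xs.
  by rewrite -(itv_partition_nil xs); exact: pc1_segment.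
apply: (@pc1_trans _ _ _ _ _ x); first exact: pc1_segment.
apply: IHs => //; first exact: itv_partition_size_neq0 xs.
by move=> i si; exact: (sP i.+1).
Qed.

End piecewise.

(** * Length as the increment of an antiderivative of the speed *)

Section arclength.
Context {R : realType} {n : nat} (M : manifold R n).
Implicit Types (gamma : R^o -> M) (h : field2 M).
Local Notation mu := (@lebesgue_measure R).

Lemma measurable_fun_seq (f : R -> R) (s : seq R) : measurable_fun [set` s] f.
Proof.
elim: s => [|x s IHs]; first by rewrite set_nil; exact: measurable_fun_set0.
have -> : [set` x :: s] = [set x] `|` [set` s] :> set R.
  apply/predeqP => y; rewrite /= inE.
  by split=> [/predU1P//|]; move/predU1P.
apply/measurable_funU => //.
  exact/countable_measurable/finite_set_countable/finite_seq.
by split => //; exact: measurable_fun_set1.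
Qed.

Lemma measurable_off_finite (f : R -> R) (s : seq R) :
  (forall x, 0 < x < 1 -> x \notin s -> {for x, continuous f}) ->
  measurable_fun `[(0 : R), 1] f.
Proof.
move=> fc.
pose O := (`]0, 1[%classic `&` ~` [set` s]) : set R.
have oO : open O.
  apply: openI; first exact: interval_open.
  apply: closed_openC; have := hausdorff_accessible (@Rhausdorff R).
  by move/accessible_finite_set_closed; apply; exact: finite_seq.
have mO : measurable_fun O f.
  apply: measurable_realfun.open_continuous_measurable_fun => // x; rewrite inE => -[].
  by rewrite /= in_itv /= => x01 /negP xs; exact: fc.
have mU : measurable_fun (O `|` [set` 0 :: 1 :: s]) f.
  apply/measurable_funU; first exact: measurable_realfun.open_measurable.
    exact/countable_measurable/finite_set_countable/finite_seq.
  by split => //; exact: measurable_fun_seq.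
apply: measurable_funS mU.
  apply: measurableU; first exact: measurable_realfun.open_measurable.
  exact/countable_measurable/finite_set_countable/finite_seq.
move=> x; rewrite /= in_itv /= => /andP[x0 x1].
have [xs|xs] := boolP (x \in s); first by right; rewrite /= !inE xs !orbT.
move: x0 x1; rewrite !le_eqVlt => /predU1P[<-|x0]; first by right; rewrite /= !inE eqxx.
move=> /predU1P[->|x1]; first by right; rewrite /= !inE eqxx orbT.
by left; split; rewrite /= ?in_itv /= ?x0//; exact/negP.
Qed.

(** [L] is the integral of the speed from 0. The fundamental theorem of calculus gives its
    derivative wherever the speed is continuous, that is, off the break points. *)
Lemma arclength_exists h gamma : is_metric h -> pc1 gamma 0 1 ->
  exists (L : R -> R) (s : seq R),
    [/\ {within `[0, 1], continuous L}, L 0 = 0,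
        curve_length h gamma = (L 1)%:E &
        forall x, 0 < x < 1 -> x \notin s ->
          C1_at gamma x /\ is_derive (x : R) 1 L (speed h gamma x)].
Proof.
move=> hm g01; have [s sC] := pc1_C1_at g01.
have [K [t tK]] := pc1_speed_bounded hm g01.
pose f : R -> R := speed h gamma.
have f0 x : 0 <= f x by exact: speed_ge0.
have mf : measurable_fun `[(0 : R), 1] f.
  apply: (@measurable_off_finite _ s) => x x01 xs.
  exact: (speed_continuous hm (sC _ x01 xs)).
(* The sum absorbs the values at the end points and at the exceptional points of [tK], about which
   [K] says nothing. *)
pose B := `|K| + \sum_(x <- 0 :: 1 :: t) f x.
have fB x : 0 <= x <= 1 -> f x <= B.
  move=> /andP[x0 x1].
  have [xt|] := boolP (x \in 0 :: 1 :: t).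
    rewrite /B -[leLHS]add0r; apply: lerD => //.
    by rewrite (big_rem _ xt) /= lerDl sumr_ge0.
  rewrite !inE !negb_or => /and3P[x0' x1' xt].
  rewrite /B -[leLHS]addr0; apply: lerD; last by rewrite sumr_ge0.
  apply: (le_trans (tK _ _ xt)); rewrite ?ler_norm//.
  by rewrite lt_neqAle eq_sym x0' x0 lt_neqAle x1' x1.
have intf : mu.-integrable `[(0 : R), 1] (EFin \o f).
  apply: measurable_bounded_integrable => //.
    by rewrite /= lebesgue_measure_itv /= lte01 oppr0 adde0 ltry.
  exists B; split; first exact: num_real.
  move=> y By x; rewrite /= in_itv /= => x01.
  by rewrite ger0_norm//; apply: (le_trans (fB _ x01)); exact: ltW.
exists (fun x => \int[mu]_(t in `[0, x]) f t)%R, s; split.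
- exact: (parameterized_integral_continuous ler01 intf).
- by rewrite set_itv1 Rintegral_set1.
- by rewrite /curve_length /Rintegral fineK//; exact: integrable_fin_num.
- move=> x x01 xs; have C1x := sC _ x01 xs; split => //.
  have /andP[x0 x1] := x01.
  have [d1 d2] := @continuous_FTC1_closed R f 0 x 1 x1 intf x0
    (speed_continuous hm C1x).
  by split; [exact: d1|rewrite -derive1E; exact: d2].
Qed.

(** Two such antiderivatives have the same increment, by monotonicity of both differences. It
    computes the length of a reparametrised or concatenated curve from an explicit [G], with no
    change of variables in the integral. *)
Lemma arclength_unique h gamma (G : R -> R) (s : seq R) : is_metric h ->
  pc1 gamma 0 1 -> {within `[0, 1], continuous G} ->
  (forall x, 0 < x < 1 -> x \notin s -> is_derive (x : R) 1 G (speed h gamma x)) ->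
  curve_length h gamma = (G 1 - G 0)%:E.
Proof.
move=> hm g01 cG dG; have [L [t [cL L0 -> tL]]] := arclength_exists hm g01.
have dGL x : 0 < x < 1 -> x \notin s ++ t ->
    [/\ derivable G x 1, derivable L x 1 & 'D_1 G x = 'D_1 L x].
  move=> x01; rewrite mem_cat negb_or => /andP[xs xt].
  have [dG1 dG2] := dG _ x01 xs; have [_ [dL1 dL2]] := tL _ x01 xt.
  by split; [exact: dG1|exact: dL1|rewrite dG2 dL2].
have GL : (G \- L) 0 <= (G \- L) 1.
  apply: (@le_derive_off_finite _ _ 0 1 (s ++ t)) => //.
    by move=> x; apply: cvgB; [exact: cG|exact: cL].
  move=> x x01 /(dGL _ x01)[dG1 dL1 E].
  by split; [exact: derivableB|rewrite deriveB// E subrr].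
have LG : (L \- G) 0 <= (L \- G) 1.
  apply: (@le_derive_off_finite _ _ 0 1 (s ++ t)) => //.
    by move=> x; apply: cvgB; [exact: cL|exact: cG].
  move=> x x01 /(dGL _ x01)[dG1 dL1 E].
  by split; [exact: derivableB|rewrite deriveB// E subrr].
by move: GL LG; rewrite /= L0 => GL LG; congr EFin; lra.
Qed.

End arclength.

(** * The distance of a metric *)

Section distance.
Context {R : realType} {n : nat} (M : manifold R n).
Implicit Types (gamma : R^o -> M) (h : field2 M).

Lemma path_from_toP (p q : M) gamma :
  path_from_to p q gamma <-> [/\ gamma 0 = p, gamma 1 = q & pc1 gamma 0 1].
Proof.
split=> [[_ g0 g1 sP]|[g0 g1 g01]].
  by split=> //; apply/pc1_partition; split.
by split=> //; [exact: pc1_continuous|have [] := (pc1_partition _ _ _).1 g01].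
Qed.

Lemma curve_length_ge0 h gamma : (0 <= curve_length h gamma)%E.
Proof. by apply: integral_ge0 => x _; rewrite lee_fin speed_ge0. Qed.

Lemma dist_ge0 h p q : (0 <= dist h p q)%E.
Proof. by apply: le_ereal_inf_tmp => _ [gamma _ <-]; exact: curve_length_ge0. Qed.

Lemma dist_le_length h p q gamma :
  path_from_to p q gamma -> (dist h p q <= curve_length h gamma)%E.
Proof. by move=> g; apply: ereal_inf_lbound; exists gamma. Qed.

Lemma is_derive_affine (L : R -> R) al be (x l : R) :
  is_derive (affine al be x : R) 1 L l ->
  is_derive x 1 (L \o affine al be : R -> R) (al * l).
Proof.
move=> [dL <-].
have E : (fun e : R => e^-1 *: ((L \o affine al be) (e *: 1 + x) -
    (L \o affine al be) x)) =
    (fun e : R => e^-1 *: (L (e *: al + affine al be x) - L (affine al be x))).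
  apply/funext => e; congr (_ *: (L _ - _)).
  by rewrite /affine /GRing.scale /=; ring.
have dF : differentiable L (affine al be x : R) by exact/derivable1_diffP.
split; first by rewrite /derivable E; exact: diff_derivable.
rewrite {1}/derive E -/(derive L (affine al be x : R) al) !deriveE//.
set y := affine al be x.
have -> : al = al *: (1 : R) by rewrite /GRing.scale /= mulr1.
by rewrite linearZ /= {1}/GRing.scale /= /GRing.scale /= mulr1.
Qed.

Lemma within_affine (L : R -> R) al be (a b a' b' : R) :
  {within `[a, b], continuous L} ->
  (forall x, a' <= x <= b' -> a <= affine al be x <= b) ->
  {within `[a', b'], continuous (L \o affine al be : R -> R)}.
Proof.
move=> cL ab; apply/subspace_continuousP => x; rewrite /= in_itv /= => xab.
move/subspace_continuousP : cL => /(_ (affine al be x)).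
rewrite /= in_itv /= => /(_ (ab _ xab)) cL.
have AA : affine al be y @[y --> within [set` `[a', b']] (nbhs (x : R))] -->
    within [set` `[a, b]] (nbhs (affine al be x)).
  move=> P NP.
  have NA : \forall y \near (x : R^o), [set` `[a, b]] (affine al be y) ->
      P (affine al be y) by exact: (@continuous_affine R al be x _ NP).
  suff : \forall y \near (x : R^o), [set` `[a', b']] y -> P (affine al be y) by [].
  near=> y; rewrite /= in_itv /= => yab; have : [set` `[a, b]] (affine al be y).
    by rewrite /= in_itv /= ab.
  by near: y.
exact: cvg_comp AA cL.
Unshelve. all: by end_near. Qed.

Lemma dist_sym_le h p q : is_metric h -> (dist h p q <= dist h q p)%E.
Proof.
move=> hm; apply: le_ereal_inf_tmp => _ [gamma /path_from_toP[g0 g1 g01] <-].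
have [L [s [cL L0 LE dL]]] := arclength_exists hm g01.
have g'01 : pc1 (gamma \o affine (-1) 1) 0 1.
  by have := pc1_rev g01; rewrite subrr subr0.
have A01 (x : R) : 0 <= x <= 1 -> 0 <= affine (-1) 1 x <= 1.
  by move=> /andP[? ?]; rewrite /affine; apply/andP; split; lra.
(* Reversal flips the sign of the derivative of the composite but not the speed; the outer minus
   restores it. *)
have cG : {within `[0, 1], continuous (fun x : R => - L (affine (-1) 1 x))}.
  by move=> x; apply: cvgN; exact: (within_affine cL A01).
have dG x : 0 < x < 1 -> x \notin map (fun x => 1 - x) s ->
    is_derive (x : R) 1 (fun x : R => - L (affine (-1) 1 x))
      (speed h (gamma \o affine (-1) 1) x).
  move=> x01 xs.
  have x01' : 0 < affine (-1) 1 x < 1.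
    by move: x01 => /andP[? ?]; rewrite /affine; apply/andP; split; lra.
  have xs' : affine (-1) 1 x \notin s.
    apply: contra xs => xs; apply/mapP; exists (affine (-1) 1 x) => //.
    by rewrite /affine; ring.
  have [C1x dLx] := dL _ x01' xs'.
  have [_ _ _ hT] := hm.
  rewrite speed_affine// normrN1 mul1r.
  have := is_deriveN (is_derive_affine dLx).
  by rewrite mulN1r opprK.
have -> : curve_length h gamma = curve_length h (gamma \o affine (-1) 1).
  rewrite (arclength_unique hm g'01 cG dG) LE /affine mulr1 addNr mulr0 add0r.
  by rewrite L0 oppr0 sub0r opprK.
apply: dist_le_length; apply/path_from_toP; split => //=.
  by rewrite /affine mulr0 add0r.
by rewrite /affine mulr1 addNr.
Qed.

(** The prefix up to [w] is rescaled to [0, 1], and the arc length of the whole curve, rescaled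
    likewise, is an antiderivative of its speed. This serves to keep an initial piece of a curve
    inside a ball around its origin. *)
Lemma dist_prefix h gamma (L : R -> R) (s : seq R) (w : R) : is_metric h ->
  pc1 gamma 0 1 -> {within `[0, 1], continuous L} ->
  (forall x, 0 < x < 1 -> x \notin s ->
    C1_at gamma x /\ is_derive (x : R) 1 L (speed h gamma x)) ->
  0 < w <= 1 -> (dist h (gamma 0%R) (gamma w) <= (L w - L 0)%:E)%E.
Proof.
move=> hm g01 cL dL /andP[w0 w1].
have g'01 : pc1 (gamma \o affine w 0) 0 1.
  have := pc1_affine_pos 0 w0 (pc1_take g01 w0 w1).
  by rewrite !subr0 mul0r divff ?gt_eqF.
have A01 (x : R) : 0 <= x <= 1 -> 0 <= affine w 0 x <= 1.
  move=> /andP[x0 x1]; rewrite /affine addr0 mulr_ge0 ?(ltW w0)//=.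
  by rewrite mulr_ile1// ltW.
have cG := within_affine cL A01.
have dG x : 0 < x < 1 -> x \notin map (fun x => x / w) s ->
    is_derive (x : R) 1 (L \o affine w 0 : R -> R) (speed h (gamma \o affine w 0) x).
  move=> /andP[x0 x1] xs.
  have x01' : 0 < affine w 0 x < 1.
    by rewrite /affine addr0 mulr_gt0//= (lt_le_trans _ w1)// gtr_pMr.
  have xs' : affine w 0 x \notin s.
    apply: contra xs => xs; apply/mapP; exists (affine w 0 x) => //.
    by rewrite /affine addr0 mulrAC divff ?mul1r// gt_eqF.
  have [C1x dLx] := dL _ x01' xs'.
  have [_ _ _ hT] := hm.
  by rewrite speed_affine// gtr0_norm//; exact: is_derive_affine.
have := arclength_unique hm g'01 cG dG; rewrite /= /affine !addr0 mulr1 mulr0 => <-.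
apply: dist_le_length; apply/path_from_toP; split => //=.
  by rewrite /affine mulr0 addr0.
by rewrite /affine mulr1 addr0.
Qed.

Lemma dist_lt_length h p q (c : \bar R) : (dist h p q < c)%E ->
  exists2 gamma, path_from_to p q gamma & (curve_length h gamma < c)%E.
Proof. by move=> /ereal_inf_lt[_ [gamma g <-] gc]; exists gamma. Qed.

(** Strict inequalities with real bounds provide a curve for each distance although the infima need
    not be attained, and spare sums of extended reals. The curves are run at double speed on the two
    halves of [0, 1], and [G] joins their arc lengths. *)
Lemma dist_triangle_lt h (p q x : M) (d r : R) : is_metric h ->
  (dist h p q < d%:E)%E -> (dist h q x < r%:E)%E ->
  (dist h p x < (d + r)%:E)%E.
Proof.
move=> hm /dist_lt_length[g1 /path_from_toP[g10 g11 g1C]] l1.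
move=> /dist_lt_length[g2 /path_from_toP[g20 g21 g2C]] l2.
have [L1 [s1 [cL1 L10 LE1 dL1]]] := arclength_exists hm g1C.
have [L2 [s2 [cL2 L20 LE2 dL2]]] := arclength_exists hm g2C.
rewrite LE1 lte_fin in l1; rewrite LE2 lte_fin in l2.
pose g (u : R^o) : M :=
  if u <= 2^-1 then (g1 \o affine 2 0) u else (g2 \o affine 2 (-1)) u.
pose G (u : R) : R :=
  if u <= 2^-1 then (L1 \o affine 2 0) u else L1 1 + (L2 \o affine 2 (-1)) u.
have h0 : 0 < (2 : R) by [].
have h2 : (2^-1 : R) < 1 by lra.
have h20 : 0 < (2^-1 : R) by lra.
have gE1 (u : R) : u <= 2^-1 -> g u = (g1 \o affine 2 0) u by rewrite /g => ->.
have gE2 (u : R) : 2^-1 <= u -> g u = (g2 \o affine 2 (-1)) u.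
  rewrite /g le_eqVlt => /predU1P[<-|]; last by rewrite ltNge => /negPf ->.
  by rewrite lexx /= /affine divff// addr0 subrr g11 g20.
have GE2 (u : R) : 2^-1 <= u -> G u = L1 1 + (L2 \o affine 2 (-1)) u.
  rewrite /G le_eqVlt => /predU1P[<-|]; last by rewrite ltNge => /negPf ->.
  by rewrite lexx /= /affine divff// addr0 subrr L20 addr0.
have gC : pc1 g 0 1.
  apply: (@pc1_trans _ _ _ _ _ 2^-1).
    apply: (@pc1_eq _ _ _ (g1 \o affine 2 0)).
      by have := pc1_affine_pos 0 h0 g1C; rewrite subrr mul0r subr0 div1r.
    by move=> u /andP[_ u2]; rewrite gE1.
  apply: (@pc1_eq _ _ _ (g2 \o affine 2 (-1))).
    have := pc1_affine_pos (-1) h0 g2C; rewrite opprK add0r div1r.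
    by rewrite -[1 + 1]/(2%:R) divff.
  by move=> u /andP[u2 _]; rewrite gE2.
have cG : {within `[0, 1], continuous G}.
  have -> : `[(0 : R), 1]%classic = `[0, 2^-1] `|` `[2^-1, 1] :> set R.
    apply/seteqP; split=> x' /=; rewrite !in_itv /=.
      move=> /andP[ux xv]; have [xw|wx] := leP x' 2^-1; first by left; rewrite ux.
      by right; rewrite xv ltW.
    move=> [/andP[ux xw]|/andP[wx xv]].
      by rewrite ux (le_trans xw)// ltW.
    by rewrite xv (le_trans _ wx)// ltW.
  apply: withinU_continuous; [exact: interval_closed|exact: interval_closed| |].
    apply: (@subspace_eq_continuous _ _ _ (L1 \o affine 2 0)).
      move=> u; rewrite inE /= in_itv /= => /andP[_ u2].
      by rewrite /from_subspace /G /= u2.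
    apply: (within_affine cL1) => u /andP[? ?]; rewrite /affine.
    by apply/andP; split; lra.
  apply: (@subspace_eq_continuous _ _ _ (fun u => L1 1 + (L2 \o affine 2 (-1)) u)).
    by move=> u; rewrite inE /= in_itv /= => /andP[u2 _]; rewrite /from_subspace GE2.
  move=> u; apply: cvgD; first exact: cvg_cst.
  apply: (@within_affine L2 2 (-1) 0 1) => // {}u /andP[? ?]; rewrite /affine.
  by apply/andP; split; lra.
have [_ _ _ hT] := hm.
have gG (u : R) : 0 < u < 1 ->
    u \notin 2^-1 :: map (fun y => y / 2) s1 ++ map (fun y => (y + 1) / 2) s2 ->
    is_derive u 1 G (speed h g u).
  move=> /andP[u0 u1]; rewrite inE mem_cat !negb_or => /and3P[u2 us1 us2].
  have [u2'|u2'|u2'] := ltgtP u 2^-1; last by rewrite u2' eqxx in u2.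
    have nu : \forall y \near u, y <= 2^-1.
      by near=> y; apply: ltW; near: y; exact: lt_nbhsl.
    have gn : {near (u : R^o), g =1 g1 \o affine 2 0}.
      by apply: filterS nu => y; exact: gE1.
    have x01' : 0 < affine 2 0 u < 1 by rewrite /affine; apply/andP; split; lra.
    have xs' : affine 2 0 u \notin s1.
      apply: contra us1 => xs; apply/mapP; exists (affine 2 0 u) => //.
      by rewrite /affine; lra.
    have [C1u dLu] := dL1 _ x01' xs'.
    rewrite (speed_near h gn) speed_affine// gtr0_norm//.
    have := is_derive_affine dLu; apply: near_eq_is_derive.
    by apply: filterS nu => y y2; rewrite /G y2.
  have nu : \forall y \near u, 2^-1 <= y.
    by near=> y; apply: ltW; near: y; exact: lt_nbhsr.
  have gn : {near (u : R^o), g =1 g2 \o affine 2 (-1)}.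
    by apply: filterS nu => y; exact: gE2.
  have x01' : 0 < affine 2 (-1) u < 1 by rewrite /affine; apply/andP; split; lra.
  have xs' : affine 2 (-1) u \notin s2.
    apply: contra us2 => xs; apply/mapP; exists (affine 2 (-1) u) => //.
    by rewrite /affine; lra.
  have [C1u dLu] := dL2 _ x01' xs'.
  rewrite (speed_near h gn) speed_affine// gtr0_norm//.
  have := is_deriveD (is_derive_cst (L1 1) u 1) (is_derive_affine dLu).
  rewrite add0r; apply: near_eq_is_derive.
  by apply: filterS nu => y y2; rewrite /= GE2.
have gL := arclength_unique hm gC cG gG.
apply: (@le_lt_trans _ _ (curve_length h g)).
  apply: dist_le_length; apply/path_from_toP; split => //.
    by rewrite gE1 ?ltW//= /affine mulr0 addr0.
  rewrite gE2 ?ltW//= /affine mulr1.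
  by have -> : 2 - 1 = 1 :> R by lra.
rewrite gL lte_fin GE2 ?ltW// /G ltW// /= /affine mulr1 mulr0 addr0 L10 subr0.
have -> : 2 - 1 = 1 :> R by lra.
by rewrite ltrD.
Unshelve. all: by end_near. Qed.

End distance.

(** * Comparison of the metrics at two times *)

(** The hypothesis makes [f x * expR (k * x)] nondecreasing and [f x * expR (- k * x)]
    nonincreasing. Inside, the sign [e] treats both at once. *)
Lemma gronwall_abs (R : realType) (f : R -> R) (k u v : R) : u <= v ->
  {within `[u, v], continuous f} ->
  (forall x, u < x < v -> derivable f x 1 /\ `|'D_1 f x| <= k * f x) ->
  f v <= expR (k * (v - u)) * f u /\ f u <= expR (k * (v - u)) * f v.
Proof.
move=> uv cf df.
have ce (a : R) : {within `[u, v], continuous (fun x => expR (a * x))}.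
  apply: continuous_subspaceT => x; apply: continuous_comp; last exact: continuous_expR.
  by apply: cvgMr; exact: cvg_id.
have de (a x : R) : is_derive x 1 (fun y => expR (a * y)) (a * expR (a * x)).
  have -> : (fun y => expR (a * y)) = expR \o affine a 0.
    by apply/funext => y; rewrite /= /affine addr0.
  have -> : a * x = affine a 0 x by rewrite /affine addr0.
  exact: is_derive_affine (is_derive_expR _).
have mono (e a : R) : e * e = 1 -> a = e * k ->
    e * (f u * expR (a * u)) <= e * (f v * expR (a * v)).
  move=> ee ak;
    apply: (@le_derive_off_finite _ (fun x => e * (f x * expR (a * x))) u v [::]) => //.
    by move=> x; apply: cvgM; [exact: cvg_cst|apply: cvgM; [exact: cf|exact: ce]].
  move=> x xuv _; have [dfx fk] := df _ xuv.
  have D1 : is_derive x 1 f ('D_1 f x) by exact/derivableP.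
  have D2 := is_deriveM D1 (de a x).
  have [D3 D4] := is_deriveZ e D2.
  split; first exact: D3.
  rewrite [leRHS]D4 /GRing.scale /=.
  have -> : e * (f x * (a * expR (a * x)) + expR (a * x) * 'D_1 f x) =
      (k * f x + e * 'D_1 f x) * expR (a * x).
    by rewrite ak -[k * f x]mul1r -ee; ring.
  apply: mulr_ge0; last exact: expR_ge0.
  have e1 : `|e| = 1.
    apply/eqP; rewrite -(@eqrXn2 _ 2)// ?expr1n//.
    by rewrite -normrX expr2 ee normr1.
  have : `|e * 'D_1 f x| <= k * f x by rewrite normrM e1 mul1r.
  by rewrite ler_norml => /andP[+ _]; lra.
have m1 := mono 1 k (mulr1 _) (esym (mul1r _)).
have m2 := mono (-1) (- k) (etrans (mulrNN 1 1) (mulr1 1)) (esym (mulN1r _)).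
have E (a b c : R) : expR (a * (b - c)) = expR (a * b) * expR (- a * c).
  by rewrite -expRD mulrBr mulNr.
split.
  have := m2; rewrite !mulN1r lerN2 => /(ler_wpM2r (expR_ge0 (k * v))).
  rewrite -!mulrA -!expRD mulNr addNr expR0 mulr1 mulrC.
  by rewrite mulNr addrC -mulrBr.
have := m1; rewrite !mul1r => /(ler_wpM2r (expR_ge0 (- (k * u)))).
rewrite -!mulrA -!expRD subrr expR0 mulr1.
by rewrite -mulrBr mulrC.
Qed.

Section time_comparison.
Context {R : realType} {n : nat} (M : manifold R n).
Implicit Types (g : R -> field2 M) (T : \bar R).

Lemma is_metric_posdef (h : field2 M) a x : is_metric h -> dom a x ->
  posdef (h a (coord a x)).
Proof.
move=> [_ hs hp _] ax; have im : (coord a @` dom a) (coord a x) by exists x.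
by split=> [|v v0]; [exact: hs|exact: hp].
Qed.

Lemma times_between T t s x : times T t -> times T s ->
  Num.min t s <= x <= Num.max t s -> times T x.
Proof.
move=> [t0 tT] [s0 sT] /andP[xl xr]; split.
  by apply: le_trans xl; rewrite le_min t0.
by apply: (@le_lt_trans _ _ (Num.max t s)%:E); [rewrite lee_fin|case: (ltP t s)].
Qed.

Lemma times_near T t : 0 < t -> (t%:E < T)%E -> \forall e \near t, times T e.
Proof.
move=> t0 tT.
have [c tc cT] : exists2 c : R, t < c & (c%:E <= T)%E.
  case: T tT => [T| |]; rewrite ?lte_fin ?ltNge ?leNye// => tT.
  - by exists T; rewrite ?ltNge.
  - by exists (t + 1); rewrite ?ltrDl// leey.
near=> e; split; first by apply: ltW; near: e; exact: lt_nbhsr.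
apply: lt_le_trans cT; rewrite lte_fin; near: e; exact: lt_nbhsl.
Unshelve. all: by end_near. Qed.

(** At a positive time all nearby times belong to [0, T), so the limit within [times T] is an
    ordinary derivative. *)
Lemma flow_is_derive T g a z i j t : ricci_flow T g -> 0 < t -> (t%:E < T)%E ->
  (coord a @` dom a) z ->
  is_derive t 1 (fun s : R => g s a z i j) (- 2 * ricci (g t a) i j z).
Proof.
move=> [_ _ _ gflow] t0 tT az.
have tt : times T t by split => //; exact: ltW.
have := gflow t a z i j tt az.
set l := - 2 * _ => Q.
have nt : \forall e \near (0 : R)^', times T (t + e).
  have := times_near t0 tT; rewrite (near_shift 0 t) => /nbhs_dnbhs.
  by apply: filterS => e; rewrite /shift /= subr0 addrC.
have QL : (h^-1 *: (g (h *: 1 + t) a z i j - g t a z i j)) @[h --> (0 : R)^'] --> l.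
  move=> P /Q; rewrite /= !nbhs_filterE /= => NP.
  near=> e; rewrite /GRing.scale /= mulr1 (addrC e t).
  have te : times T (t + e) by near: e.
  move: te; near: e; exact: NP.
split; first by apply/cvg_ex; exists l.
exact: cvg_lim.
Unshelve. all: by end_near. Qed.

Lemma flow_quad_is_derive T g a z v t : ricci_flow T g -> 0 < t -> (t%:E < T)%E ->
  (coord a @` dom a) z ->
  is_derive t 1 (fun s : R => quad_form (g s a z) v)
    (- 2 * \sum_i \sum_j v 0 i * v 0 j * ricci (g t a) i j z).
Proof.
move=> gf t0 tT az.
have -> : (fun s : R => quad_form (g s a z) v) =
    \sum_i \sum_j (fun s => v 0 i * v 0 j * g s a z i j).
  apply/funext => s; rewrite quad_formE fct_sumE; apply: eq_bigr => i _.
  by rewrite fct_sumE.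
have D i j := is_deriveZ (v 0 i * v 0 j) (flow_is_derive i j gf t0 tT az).
have D' i := is_derive_sum (fun j => D i j).
have D'' := is_derive_sum (fun i => D' i).
apply: is_derive_eq D'' _; rewrite mulr_sumr; apply: eq_bigr => i _.
by rewrite mulr_sumr; apply: eq_bigr => j _; rewrite /GRing.scale /=; ring.
Qed.

(** The interval may start at time 0, where no two-sided derivative is available. Continuity there
    comes from the local smooth extensions in the definition of the flow. *)
Lemma flow_quad_continuous T g a z v t s : ricci_flow T g ->
  times T t -> times T s -> (coord a @` dom a) z ->
  {within `[t, s], continuous (fun u : R => quad_form (g u a z) v)}.
Proof.
move=> [_ _ gs _] tt ts az.
have -> : (fun u : R => quad_form (g u a z) v) =
    fun u => \sum_i \sum_j v 0 i * v 0 j * g u a z i j.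
  by apply/funext => u; rewrite quad_formE.
apply/subspace_continuousP => x; rewrite /= in_itv /= => /andP[tx xs].
apply: (@cvg_sumr R _ _ _ _ _ (fun i u => \sum_j _)) => i.
apply: (@cvg_sumr R _ _ _ _ _ (fun j u => v 0 i * v 0 j * g u a z i j)) => j.
apply: cvgMr.
have xT : times T x.
  by apply: (times_between tt ts); rewrite ge_min le_max tx xs orbT.
have [U [F [oU Ux CF UF]]] := gs a i j (x, z) (conj xT az).
have Fc : {for (x, z), continuous F} by exact: Ck_continuous (CF 0%N) Ux.
have pc : (u, z) @[u --> (x : R^o)] --> ((x : R^o), z).
  exact: (@cvg_pair _ _ _ (nbhs (x : R^o)) (nbhs (x : R^o)) (nbhs z) _ _ _ id
    (fun=> z) cvg_id (cvg_cst z)).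
have nU : \forall u \near (x : R^o), U (u, z).
  by apply: pc; exact: open_nbhs_nbhs.
rewrite -(UF (x, z) Ux (conj xT az)).
have : F (u, z) @[u --> within [set` `[t, s]] (nbhs (x : R^o))] --> F (x, z).
  by apply: cvg_within_filter; apply: (@cvg_comp _ _ _ _ F _ _ _ pc); exact: Fc.
apply: cvg_trans; apply: near_eq_cvg; rewrite near_withinE; near=> u => /=.
rewrite in_itv /= => /andP[tu us].
apply: (UF (u, z)); first by near: u.
split => //=; apply: (times_between tt ts); by rewrite ge_min le_max tu us orbT.
Unshelve. all: by end_near. Qed.

Lemma riemann_ricci_bound (h : field2 M) a x (v : 'rV[R]_n) : is_metric h -> dom a x ->
  `|\sum_i \sum_j v 0 i * v 0 j * ricci (h a) i j (coord a x)| <=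
    n%:R ^+ 3 * quad_form (h a (coord a x)) v * riemann_norm (h a) (coord a x).
Proof. by move=> hm ax; exact: ricci_contraction_bound (is_metric_posdef hm ax). Qed.

(* The curvature bound may hold in another chart at each time. That Ric is a
   tensor follows from the flow equation, because the metric is one. *)
Lemma flow_quad_derive_bound T g x c b v t : ricci_flow T g -> 0 < t ->
  (t%:E < T)%E -> dom b x -> riemann_lt (g t) x c ->
  let f s := quad_form (g s b (coord b x)) v in
  derivable f t 1 /\ `|'D_1 f t| <= 2 * n%:R ^+ 3 * c * f t.
Proof.
move=> gf t0 tT bx [a ax rc] f; have [_ gm _ _] := gf.
have tt : times T t by split => //; exact: ltW.
have bz : (coord b @` dom b) (coord b x) by exists x.
have az : (coord a @` dom a) (coord a x) by exists x.
have [df _] := flow_quad_is_derive v gf t0 tT bz; split => //.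
pose w := v *m jacobian b a (coord b x).
have fE s : times T s -> f s = quad_form (g s a (coord a x)) w.
  move=> sT; have [_ _ _ gT] := gm _ sT.
  by rewrite /f (gT b a x bx ax) /w quad_form_mulmx.
have -> : 'D_1 f t = 'D_1 (fun s : R => quad_form (g s a (coord a x)) w) t.
  apply: near_eq_derive; have := times_near t0 tT.
  by apply: filterS => s; exact: fE.
have [_ ->] := flow_quad_is_derive w gf t0 tT az.
have q0 : 0 <= quad_form (g t a (coord a x)) w.
  have [_] := is_metric_posdef (gm _ tt) ax.
  have [->|w0 /(_ _ w0)/ltW//] := eqVneq w 0.
  by rewrite /quad_form !mul0mx mxE.
rewrite normrM normrN normr_nat fE//.
rewrite [leRHS](_ : _ =
  2 * (n%:R ^+ 3 * quad_form (g t a (coord a x)) w * c)); last by ring.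
rewrite ler_wpM2l//; apply: (le_trans (riemann_ricci_bound w (gm _ tt) ax)).
by rewrite ler_wpM2l ?mulr_ge0 ?exprn_ge0// ltW.
Qed.

(** Gronwall for the squared length of a fixed vector [v]. The curvature bound is asked only at
    times strictly between [t] and [s], because either may be 0, a time that no parabolic cylinder
    contains. *)
Lemma flow_quad_compare T g x c b v t s : ricci_flow T g ->
  times T t -> times T s -> dom b x ->
  (forall u, Num.min t s < u < Num.max t s -> riemann_lt (g u) x c) ->
  quad_form (g t b (coord b x)) v <=
    expR (2 * n%:R ^+ 3 * c * `|t - s|) * quad_form (g s b (coord b x)) v.
Proof.
move=> gf tT sT bx rlt.
have bz : (coord b @` dom b) (coord b x) by exists x.
have H (t1 t2 : R) : times T t1 -> times T t2 -> t1 <= t2 ->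
    (forall u, t1 < u < t2 -> riemann_lt (g u) x c) ->
    let f u := quad_form (g u b (coord b x)) v in
    f t2 <= expR (2 * n%:R ^+ 3 * c * (t2 - t1)) * f t1 /\
    f t1 <= expR (2 * n%:R ^+ 3 * c * (t2 - t1)) * f t2.
  move=> t1T t2T t12 rl f; apply: gronwall_abs => //.
    exact: flow_quad_continuous gf t1T t2T bz.
  move=> u u12; have /andP[u1 u2] := u12.
  have u0 : 0 < u by case: t1T => t10 _; exact: le_lt_trans u1.
  have uT : (u%:E < T)%E by case: t2T => _; apply: lt_trans; rewrite lte_fin.
  exact: flow_quad_derive_bound gf u0 uT bx (rl _ u12).
have [ts|st] := leP t s.
  have [|_ le_ts] := H t s tT sT ts.
    by move=> u; have := rlt u; rewrite (min_idPl ts) (max_idPr ts); apply.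
  by rewrite ler0_norm ?subr_le0// opprB; exact: le_ts.
have [|le_st _] := H s t sT tT (ltW st).
  by move=> u; have := rlt u; rewrite (min_idPr (ltW st)) (max_idPl (ltW st)); apply.
by rewrite ger0_norm ?subr_ge0 ?(ltW st)//; exact: le_st.
Qed.

Lemma ball_compare T g p x r r' t s : ricci_flow T g ->
  times T t -> times T s ->
  (forall y u, (dist (g t) p y < r%:E)%E -> Num.min t s < u < Num.max t s ->
    riemann_lt (g u) y (r ^- 2)) ->
  expR (n%:R ^+ 3 * r ^- 2 * `|t - s|) * r' <= r ->
  (dist (g s) p x < r'%:E)%E -> (dist (g t) p x < r%:E)%E.
Proof.
move=> gf tT sT rlt; set la := expR _ => lar dx.
have [_ gm _ _] := gf.
have [gamma /path_from_toP[g0 g1 gC] gl] := dist_lt_length dx.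
have [Ls [ss [cLs Ls0 LsE dLs]]] := arclength_exists (gm _ sT) gC.
have [Lt [st [cLt Lt0 LtE dLt]]] := arclength_exists (gm _ tT) gC.
rewrite LsE lte_fin in gl.
have la0 : 0 < la by exact: expR_gt0.
have laLs : la * Ls 1 < r by apply: lt_le_trans lar; rewrite ltr_pM2l.
have Ls1 : 0 <= Ls 1.
  by rewrite -lee_fin -LsE curve_length_ge0.
apply: (@le_lt_trans _ _ (Lt 1)%:E).
  by rewrite -LtE; apply: dist_le_length; apply/path_from_toP.
rewrite lte_fin ltNge; apply/negP => rLt.
(* A length level strictly between [la * Ls 1] and [r]. If the curve reached it for [g t], at
   parameter [w], the prefix would lie in the ball, and the comparison would give
   [v <= la * Ls w <= la * Ls 1 < v]. *)
pose v := (la * Ls 1 + r) / 2.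
have v1 : la * Ls 1 < v by rewrite /v; lra.
have v2 : v < r by rewrite /v; lra.
have v0 : 0 < v by apply: le_lt_trans v1; rewrite mulr_ge0// ltW.
have [w + Lw] : exists2 w, w \in `[0, 1]%R & Lt w = v.
  apply: IVT => //; rewrite Lt0 ge_min le_max (ltW v0)/=.
  by rewrite (le_trans (ltW v2) rLt) orbT.
rewrite in_itv /= => /andP[w0 w1].
have w0' : 0 < w.
  by rewrite lt_neqAle w0 andbT; apply/eqP => w0'; move: v0; rewrite -Lw -w0' Lt0 ltxx.
have Ltmono (a b : R) : 0 <= a -> a <= b -> b <= 1 -> Lt a <= Lt b.
  move=> a0 ab b1; apply: (@le_derive_off_finite _ Lt a b st) => //.
    by apply: continuous_subspaceW cLt; apply: subset_itv; rewrite bnd_simp.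
  move=> y /andP[ay yb] yst;
  have y01 : 0 < y < 1 by rewrite (le_lt_trans a0)// (lt_le_trans yb).
  have [_ [d1 d2]] := dLt y y01 yst.
  by split => //; rewrite d2; exact: speed_ge0.
have Lsmono (a b : R) : 0 <= a -> a <= b -> b <= 1 -> Ls a <= Ls b.
  move=> a0 ab b1; apply: (@le_derive_off_finite _ Ls a b ss) => //.
    by apply: continuous_subspaceW cLs; apply: subset_itv; rewrite bnd_simp.
  move=> y /andP[ay yb] yst.
  have y01 : 0 < y < 1 by rewrite (le_lt_trans a0)// (lt_le_trans yb).
  have [_ [d1 d2]] := dLs y y01 yst.
  by split => //; rewrite d2; exact: speed_ge0.
suff : Lt w <= la * Ls w.
  rewrite Lw => /(lt_le_trans v1); rewrite ltr_pM2l// ltNge.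
  by rewrite Lsmono// ltW.
pose F := fun y : R => la * Ls y - Lt y.
suff : F 0 <= F w by rewrite /F Ls0 Lt0 mulr0 subr0 subr_ge0.
apply: (@le_derive_off_finite R F 0 w (ss ++ st) w0).
  have sub : `[0, w] `<=` `[0, 1] by apply: subset_itv; rewrite bnd_simp.
  move=> y; apply: cvgB; last exact: (continuous_subspaceW sub cLt).
  by apply: cvgMr; exact: (continuous_subspaceW sub cLs).
move=> y /andP[y0 yw]; rewrite mem_cat negb_or => /andP[ys yt].
have y01 : 0 < y < 1 by rewrite y0 (lt_le_trans yw).
have [C1y dLty] := dLt y y01 yt; have [_ dLsy] := dLs y y01 ys.
have [D1 D2] := is_deriveB (is_deriveZ la dLsy) dLty.
split; first exact: D1.
rewrite [leRHS]D2 subr_ge0.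
have dy : (dist (g t) p (gamma y) < r%:E)%E.
  have := dist_prefix (gm _ tT) gC cLt dLt (w := y).
  rewrite g0 Lt0 subr0 => /(_ _)/wrap[]; first by rewrite y0 ltW// (lt_le_trans yw).
  move=> /le_lt_trans; apply; rewrite lte_fin; apply: le_lt_trans v2.
  by rewrite -Lw; apply: Ltmono => //; exact: ltW.
rewrite /speed; set b := chart_at _; set D := 'D_1 _ y.
have by_ : dom b (gamma y) by rewrite /b /chart_at; case: cid.
have := flow_quad_compare D gf tT sT by_ (fun u => rlt (gamma y) u dy).
(* Quadratic forms compare up to [la ^+ 2], hence speeds up to [la]; this is why the exponent of
   [la] lacks the factor 2. *)
have -> : expR (2 * n%:R ^+ 3 * r ^- 2 * `|t - s|) = la ^+ 2.
  by rewrite /la -expRM_natl; congr expR; ring.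
move=> le2; rewrite -[leRHS]/(la * _) -[la]gtr0_norm// -sqrtr_sqr -sqrtrM ?sqr_ge0//.
by rewrite ler_wsqrtr.
Qed.

End time_comparison.

(** * Small balls *)

Section small_balls.
Context {R : realType} {n : nat} (M : manifold R n).
Implicit Types (gamma : R^o -> M) (h : field2 M).

Lemma speed_in_chart h gamma (a : chart M) (u : R) : tensor_law h ->
  C1_at gamma u -> dom a (gamma u) ->
  derivable (coord a \o gamma : R -> 'rV[R]_n) u 1 /\
  speed h gamma u =
    Num.sqrt (quad_form (h a (coord a (gamma u)))
      ('D_1 (coord a \o gamma : R -> 'rV[R]_n) u)).
Proof.
move=> hT [b [U [F [C1 Uu]]]] au; have [_ _ UF] := C1; have [bu Fu] := UF _ Uu.
have [d1 d2] := C1_chart_deriv C1 Uu au; split; first exact: d1.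
rewrite (speedE hT C1 Uu) Fu (hT b a _ bu au) -quad_form_mulmx.
by congr (Num.sqrt (quad_form _ _)); rewrite -d2.
Qed.

Lemma quad_form_perturb m (A B : 'M[R]_m) (e : R) v :
  (forall i j, `|A i j - B i j| <= e) ->
  quad_form B v - m%:R ^+ 2 * e * `|v| ^+ 2 <= quad_form A v.
Proof.
move=> ABe; rewrite lerBlDr -lerBlDl.
apply: (le_trans (ler_norm _)).
rewrite !quad_formE -sumrB; apply: (le_trans (ler_norm_sum _ _ _)).
apply: (@le_trans _ _ (\sum_(i < m) \sum_(j < m) e * `|v| ^+ 2)).
  apply: ler_sum => i _; rewrite -sumrB; apply: (le_trans (ler_norm_sum _ _ _)).
  apply: ler_sum => j _; rewrite -mulrBr !normrM mulrC expr2.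
  have vle k : `|v 0 k| <= `|v| by exact: ler_mx_norm.
  by apply: ler_pM; rewrite ?mulr_ge0 ?ler_pM// distrC.
by rewrite !sumr_const !card_ord -[leLHS]mulr_natl -[X in _ * X]mulr_natl !mulrA.
Qed.

Lemma metric_lower_bound h (a : chart M) p (V : set 'rV[R]_n) : is_metric h ->
  dom a p -> nbhs (coord a p) V ->
  exists (k r : R), [/\ 0 < k, 0 < r & forall z, `|coord a p - z| < r ->
    [/\ (coord a @` dom a) z, V z &
        forall v, k * `|v| <= Num.sqrt (quad_form (h a z) v)]].
Proof.
move=> hm ap pV; set z0 := coord a p.
have z0im : (coord a @` dom a) z0 by exists p.
have [c c0 cP] := posdef_coercive (is_metric_posdef hm ap).
have [hC _ _ _] := hm.
(* Entries varying by at most [e] change the form by at most [n^2 * e * |v|^2], which is at most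
   half of the coercivity bound; the other half gives the constant [Num.sqrt (c / 2)]. The added 1
   keeps the denominator positive for n = 0. *)
pose e := c / (2 * (n%:R ^+ 2 + 1)).
have n1 : 0 < n%:R ^+ 2 + 1 :> R by rewrite ltr_wpDl// exprn_ge0.
have e0 : 0 < e by rewrite divr_gt0// mulr_gt0.
have hn i j : \forall z \near z0, `|h a z i j - h a z0 i j| <= e.
  have hc : {for z0, continuous (fun z => h a z i j)}.
    exact: Ck_continuous (hC a i j 0%N) z0im.
  by move/cvgr_distC_le : hc; apply.
have hn' : \forall z \near z0, forall ij : 'I_n * 'I_n,
    `|h a z ij.1 ij.2 - h a z0 ij.1 ij.2| <= e.
  exact: (@filter_forall _ _ (fun (ij : 'I_n * 'I_n) z =>
    `|h a z ij.1 ij.2 - h a z0 ij.1 ij.2| <= e) (nbhs z0) _ (fun ij => hn _ _)).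
have imn : \forall z \near z0, (coord a @` dom a) z.
  by apply: open_nbhs_nbhs; split => //; exact: image_open.
have : \forall z \near z0, [/\ (coord a @` dom a) z, V z & forall ij : 'I_n * 'I_n,
    `|h a z ij.1 ij.2 - h a z0 ij.1 ij.2| <= e].
  near=> z; split; by near: z.
move=> /nbhs_ballP[r /= r0 rP]; exists (Num.sqrt (c / 2)), r; split => //.
  by rewrite sqrtr_gt0 divr_gt0.
move=> z zr; have [|zim Vz ze] := rP z; first by rewrite -ball_normE.
split => // v; rewrite -[`|v|]normr_id -sqrtr_sqr.
have c20 : 0 <= c / 2 by lra.
rewrite -sqrtrM//; apply: ler_wsqrtr.
have := @quad_form_perturb _ (h a z) (h a z0) e v (fun i j => ze (i, j)).
apply: le_trans.
apply: (@le_trans _ _ (c * `|v| ^+ 2 - n%:R ^+ 2 * e * `|v| ^+ 2)); last first.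
  by rewrite lerD2r cP.
rewrite -mulrBl ler_wpM2r ?exprn_ge0//.
have : n%:R ^+ 2 * e <= c / 2.
  have -> : c / 2 = (n%:R ^+ 2 + 1) * e by rewrite /e; field; rewrite gt_eqF.
  by rewrite ler_wpM2r ?(ltW e0)// lerDl.
lra.
Unshelve. all: by end_near. Qed.

(** Leaving the coordinate ball of radius [r] costs length at least [k * r]. Before the first exit
    time [W] a shorter curve stays in a smaller closed coordinate ball. Its image under [param a] is
    compact, hence closed in the Hausdorff space [M], so it still contains the point at time [W]:
    there is no exit. *)
Lemma small_ball h (a : chart M) p (V : set 'rV[R]_n) : is_metric h ->
  dom a p -> nbhs (coord a p) V ->
  exists2 d : R, 0 < d & forall x, (dist h p x < d%:E)%E ->
    dom a x /\ V (coord a x).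
Proof.
move=> hm ap pV; set z0 := coord a p.
have [k [r [k0 r0 krP]]] := metric_lower_bound hm ap pV; rewrite -/z0 in krP.
exists (k * r) => [|x]; first exact: mulr_gt0.
move=> /dist_lt_length[gamma /path_from_toP[g0 g1 gC]].
have [L [s [cL L0 -> dL]]] := arclength_exists hm gC.
rewrite lte_fin => Lr; have [_ _ _ hT] := hm.
have gcont := pc1_continuous gC.
pose V0 : set M := [set y | dom a y /\ `|z0 - coord a y| < r].
have V0near y : V0 y -> nbhs y V0.
  move=> [ay yr].
  have n1 : \forall u \near y, dom a u.
    by apply: open_nbhs_nbhs; split => //; exact: dom_open.
  have n2 : \forall u \near y, `|z0 - coord a u| < r.
    have cc := coord_continuous ay.
    have : `|z0 - coord a u| @[u --> y] --> `|z0 - coord a y|.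
      by apply: cvg_norm; apply: cvgB; [exact: cvg_cst|exact: cc].
    by move/cvgr_lt; apply.
  by near=> u; split; near: u.
suff gV w : 0 <= w <= 1 -> V0 (gamma w).
  have [|a1 c1] := gV 1; first by rewrite ler01 lexx.
  by rewrite g1 in a1 c1; split => //; have [] := krP _ c1.
have [//|nV w01] := pselect (V0 (gamma w)); exfalso.
pose N : set R := [set y | 0 <= y <= 1 /\ ~ V0 (gamma y)].
have Nw : N w by [].
have infN : has_inf N by split; [exists w|exists 0 => y [/andP[]]].
pose W := inf N.
have W0 : 0 <= W by apply: lb_le_inf; [exists w|move=> y [/andP[]]].
have W1 : W <= 1.
  by apply: (@le_trans _ _ w); [apply: ge_inf => //; exact: infN.2|case/andP: w01].
have V0p : V0 (gamma 0) by rewrite g0; split => //; rewrite subrr normr0.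
have below y : 0 <= y -> y < W -> V0 (gamma y).
  move=> y0 yW; have [//|nVy] := pselect (V0 (gamma y)); exfalso.
  have : W <= y.
    apply: ge_inf; first exact: infN.2.
    by split => //; rewrite y0 (le_trans (ltW yW)).
  by rewrite leNgt yW.
have gcW : gamma y @[y --> within [set` `[0, 1]] (nbhs (W : R))] --> gamma W.
  by move/subspace_continuousP : gcont; apply; rewrite /= in_itv /= W0.
have nVW : ~ V0 (gamma W).
  move=> /V0near /gcW; rewrite /= /within /= nbhs_filterE => /nbhs_ballP[e /= e0 eP].
  have [y [y01 nVy] yW] := inf_adherent e0 infN.
  have Wy : W <= y by apply: ge_inf; [exact: infN.2|split].
  apply: nVy; apply: eP; last by rewrite /= in_itv.
  rewrite -ball_normE /= ler0_norm ?opprB ?ltrBlDl//.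
  by rewrite subr_le0.
have W0' : 0 < W.
  by rewrite lt_neqAle W0 andbT; apply/eqP => W0'; apply: nVW; rewrite -W0'.
have Lmono (u v : R) : 0 <= u -> u <= v -> v <= 1 -> L u <= L v.
  move=> u0 uv v1; apply: (@le_derive_off_finite _ L u v s uv).
    by apply: continuous_subspaceW cL; apply: subset_itv; rewrite bnd_simp.
  move=> y /andP[uy yv] ys.
  have y01 : 0 < y < 1 by rewrite (le_lt_trans u0)// (lt_le_trans yv).
  have [_ [d1 d2]] := dL y y01 ys.
  by split; [exact: d1|rewrite d2; exact: speed_ge0].
pose c (i : 'I_n) := fun y : R => coord a (gamma y) 0 i.
have cc i y : 0 <= y -> y < W -> {within `[0, y], continuous (c i)}.
  move=> y0 yW; apply/subspace_continuousP => u; rewrite /= in_itv /= => /andP[u0 uy].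
  have [au _] := below _ u0 (le_lt_trans uy yW).
  have cu : {for gamma u, continuous (fun q => coord a q 0 i)}.
    apply: (@continuous_comp _ _ _ (coord a) (fun q => q 0 i)).
      exact: coord_continuous.
    exact: matrix_normedtype.coord_continuous.
  have gu : gamma y0 @[y0 --> within [set` `[0, y]] (nbhs (u : R))] --> gamma u.
    have sub : `[0, y] `<=` `[(0 : R), 1].
      by apply: subset_itv; rewrite bnd_simp // (le_trans (ltW yW)).
    have := continuous_subspaceW sub gcont.
    by move/subspace_continuousP; apply; rewrite /= in_itv /= u0.
  exact: cvg_comp gu cu.
(* The norm on row vectors is the maximum norm, so it suffices to bound each coordinate with both
   signs [e]; the norm itself is never differentiated. *)
have inc (e : R) i y : e = 1 \/ e = -1 -> 0 <= y -> y < W ->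
    e * k * (c i y - c i 0) <= L y.
  move=> e1 y0 yW.
  have aux (d D : R) : `|d| <= D -> e * k * d <= k * D.
    move=> dD; rewrite mulrAC mulrC ler_wpM2l ?(ltW k0)//.
    apply: le_trans dD; apply: (le_trans (ler_norm _)); rewrite normrM.
    by case: e1 => ->; rewrite ?normrN normr1 mul1r.
  pose F := fun u : R => L u - e * k * c i u.
  suff : F 0 <= F y by rewrite /F L0; lra.
  have y1 : y <= 1 by rewrite (le_trans (ltW yW)).
  apply: (@le_derive_off_finite R F 0 y s y0).
    have sub : `[0, y] `<=` `[(0 : R), 1] by apply: subset_itv; rewrite bnd_simp.
    move=> u; apply: cvgB; first exact: (continuous_subspaceW sub cL).
    by apply: cvgMr; exact: cc.
  move=> u /andP[u0 uy] us; have u01 : 0 < u < 1 by rewrite u0 (lt_le_trans uy).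
  have [C1u dLu] := dL u u01 us.
  have [au cu] := below u (ltW u0) (lt_trans uy yW).
  have [d1 spE] := speed_in_chart hT C1u au.
  have di : derivable (c i) u 1 by exact: (derivable_mxP _ _ _).1 d1 0 i.
  have D1 : is_derive u 1 (c i) ('D_1 (c i) u) by exact/derivableP.
  have [D2 D3] := is_deriveB dLu (is_deriveZ (e * k) D1).
  split; first exact: D2.
  rewrite [leRHS]D3 subr_ge0.
  have dD : `|'D_1 (c i) u| <= `|'D_1 (coord a \o gamma : R -> 'rV[R]_n) u|.
    apply: le_trans (ler_mx_norm _ 0 i).
    by rewrite (derive_mx d1) mxE; exact: lexx.
  apply: (le_trans (aux _ _ dD)); rewrite spE.
  by have [_ _] := krP _ cu; apply.
(* The midpoint between the bound [L 1 / k] on the coordinate displacement and [r], leaving room for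
   a closed ball inside the open one. *)
pose r' := (L 1 / k + r) / 2.
have L1r : L 1 / k < r by rewrite ltr_pdivrMr// mulrC.
have L1k : 0 <= L 1 / k.
  by rewrite divr_ge0// ?(ltW k0)// -L0; apply: Lmono; rewrite ?ler01.
have r'0 : 0 < r' by rewrite /r'; lra.
have r'r : r' < r by rewrite /r'; lra.
have r'L : L 1 / k <= r' by rewrite /r'; lra.
have H1 (X : R) : 1 * k * X = X * k by ring.
have H2 (X : R) : -1 * k * X = - X * k by ring.
have near_p y : 0 <= y -> y < W -> `|z0 - coord a (gamma y)| <= r'.
  move=> y0 yW; apply: mx_norm_ler => [|i0 i]; first exact: ltW.
  rewrite ord1 !mxE distrC; apply: le_trans r'L.
  rewrite ler_pdivlMr//.
  have Ly : L y <= L 1 by apply: Lmono => //; rewrite (le_trans (ltW yW)).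
  have i1 := inc 1 i y (or_introl erefl) y0 yW.
  have i2 := inc (-1) i y (or_intror erefl) y0 yW.
  rewrite /c g0 -/z0 in i1 i2.
  have [cp|cn] := lerP 0 (coord a (gamma y) 0 i - z0 0 i).
    by apply: le_trans Ly; rewrite (ger0_norm cp) -H1; exact: i1.
  by apply: le_trans Ly; rewrite (ltr0_norm cn) -H2; exact: i2.
pose B : set 'rV[R]_n := closed_ball z0 r'.
have BE z : B z <-> `|z0 - z| <= r' by rewrite /B closed_ballE.
have Bim z : B z -> (coord a @` dom a) z.
  by move=> /BE zr; have [] := krP z (le_lt_trans zr r'r).
have Bc : compact B.
  apply: bounded_closed_compact; last exact: closed_ball_closed.
  exists (`|z0| + r'); split=> [|K /ltW zK z /BE zr]; first exact: num_real.
  apply: le_trans zK; rewrite -[z](subKr z0) /=.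
  by apply: (le_trans (ler_normB _ _)); rewrite lerD2l.
have Kc : closed (param a @` B).
  apply: compact_closed; first exact: manifold_hausdorff.
  apply: continuous_compact => //; apply/subspace_continuousP => z Bz.
  by apply: cvg_within_filter; exact: param_continuous (Bim _ Bz).
(* Closedness lets the left limit of the curve at [W] be taken in [M], without assuming that
   [coord a] is meaningful there. *)
have KW : (param a @` B) (gamma W).
  apply: (@closed_cvg _ _ (W^'-) _ gamma _ Kc).
    near=> y; have yW : y < W by near: y; exact: nbhs_left_lt.
    have y0 : 0 <= y by apply: ltW; near: y; exact: nbhs_left_gt.
    have [ay _] := below y y0 yW.
    by exists (coord a (gamma y)); [apply/BE; exact: near_p|rewrite coordK].
  move=> P /gcW NP.
  have NP' : \forall y \near W^'-, [set` `[0, 1]] y -> P (gamma y).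
    have NP0 : \forall y \near (W : R), [set` `[0, 1]] y -> P (gamma y) by exact: NP.
    by rewrite near_withinE; apply: filterS NP0 => y + _; apply.
  rewrite /= nbhs_filterE /=; near=> y.
  have y01 : [set` `[0, 1]] y.
    rewrite /= in_itv /=; apply/andP; split; apply: ltW.
      by near: y; exact: nbhs_left_gt.
    by apply: lt_le_trans W1; near: y; exact: nbhs_left_lt.
  by move: y01; near: y.
apply: nVW; case: KW => z Bz <-; have [y ay yz] := Bim _ Bz.
rewrite -yz coordK//; split => //; rewrite yz.
by apply: le_lt_trans r'r; apply/BE.
Unshelve. all: by end_near. Qed.

End small_balls.

(** * Local boundedness of the curvature *)

Section local_extension.
Context {R : realType} {n : nat} (T : \bar R) (A : set 'rV[R]_n).
Hypothesis openA : open A.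
Variables (t0 : R) (z0 : 'rV[R]_n).
Hypothesis t0T : times T t0.
Hypothesis z0A : A z0.
Implicit Types (phi psi : R -> 'rV[R]_n -> R).

(* Since [times T] need not be open, the functions of interest are handled
   through C^k extensions to a neighbourhood of [(t0, z0)]. *)
Definition Ck_ext (k : nat) phi := exists (U : set (R^o * 'rV[R]_n))
    (F : R^o * 'rV[R]_n -> R),
  [/\ open U, U (t0 : R^o, z0), Ck k U F &
    forall t z, U (t : R^o, z) -> times T t -> A z -> F (t : R^o, z) = phi t z].

Lemma Ck_ext_eq k phi psi : (forall t z, times T t -> A z -> phi t z = psi t z) ->
  Ck_ext k phi -> Ck_ext k psi.
Proof.
move=> E [U [F [oU U0 CF FE]]]; exists U, F; split => // t z Utz tT Az.
by rewrite FE// E.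
Qed.

Lemma Ck_ext_cst k (c : R) : Ck_ext k (fun _ _ => c).
Proof.
by exists setT, (fun=> c); split => //; [exact: openT|exact: Ck_cst].
Qed.

Lemma Ck_extD k phi psi : Ck_ext k phi -> Ck_ext k psi ->
  Ck_ext k (fun t z => phi t z + psi t z).
Proof.
move=> [U [F [oU U0 CF FE]]] [V [G [oV V0 CG GE]]].
have oUV := openI oU oV.
exists (U `&` V), (fun x => F x + G x); split => //.
- by apply: CkD => //; [apply: CkW CF => x []|apply: CkW CG => x []].
- by move=> t z [Ut Vt] tT Az; rewrite FE// GE.
Qed.

Lemma Ck_extM k phi psi : Ck_ext k phi -> Ck_ext k psi ->
  Ck_ext k (fun t z => phi t z * psi t z).
Proof.
move=> [U [F [oU U0 CF FE]]] [V [G [oV V0 CG GE]]].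
have oUV := openI oU oV.
exists (U `&` V), (fun x => F x * G x); split => //.
- by apply: CkM => //; [apply: CkW CF => x []|apply: CkW CG => x []].
- by move=> t z [Ut Vt] tT Az; rewrite FE// GE.
Qed.

Lemma Ck_extB k phi psi : Ck_ext k phi -> Ck_ext k psi ->
  Ck_ext k (fun t z => phi t z - psi t z).
Proof.
move=> Cp Cq; have := Ck_extD Cp (Ck_extM (Ck_ext_cst k (-1)) Cq).
by apply: Ck_ext_eq => t z _ _; rewrite mulN1r.
Qed.

Lemma Ck_extV k phi : phi t0 z0 != 0 -> Ck_ext k phi ->
  Ck_ext k (fun t z => (phi t z)^-1).
Proof.
move=> p0 [U [F [oU U0 CF FE]]].
have F0 : F (t0 : R^o, z0) != 0 by rewrite FE.
pose V := U `&` [set x | F x != 0].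
have oV : open V.
  rewrite openE => x [Ux Fx].
  have Fc : {for x, continuous F} by exact: Ck_continuous CF Ux.
  have n1 : \forall y \near x, U y by exact: open_nbhs_nbhs.
  have n2 : \forall y \near x, F y != 0 by exact: (cvgr_neq0 _ Fc).
  by rewrite /interior; near=> y; split; near: y.
exists V, (fun x => (F x)^-1); split => //.
- by apply: CkV => //; [move=> x []|apply: CkW CF => x []].
- by move=> t z [Ut _] tT Az; rewrite FE.
Unshelve. all: by end_near. Qed.

Lemma Ck_ext_sum k (I : Type) (s : seq I) (phi : I -> R -> 'rV[R]_n -> R) :
  (forall i, Ck_ext k (phi i)) -> Ck_ext k (fun t z => \sum_(i <- s) phi i t z).
Proof.
move=> Cp; elim: s => [|i s IHs].
  by apply: Ck_ext_eq (Ck_ext_cst k 0) => t z _ _; rewrite big_nil.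
by apply: Ck_ext_eq (Ck_extD (Cp i) IHs) => t z _ _; rewrite big_cons.
Qed.

Lemma Ck_ext_prod k (I : Type) (s : seq I) (phi : I -> R -> 'rV[R]_n -> R) :
  (forall i, Ck_ext k (phi i)) -> Ck_ext k (fun t z => \prod_(i <- s) phi i t z).
Proof.
move=> Cp; elim: s => [|i s IHs].
  by apply: Ck_ext_eq (Ck_ext_cst k 1) => t z _ _; rewrite big_nil.
by apply: Ck_ext_eq (Ck_extM (Cp i) IHs) => t z _ _; rewrite big_cons.
Qed.

Lemma Ck_ext_det k m (B : R -> 'rV[R]_n -> 'M[R]_m) :
  (forall i j, Ck_ext k (fun t z => B t z i j)) -> Ck_ext k (fun t z => \det (B t z)).
Proof.
move=> CB; rewrite /determinant; apply: Ck_ext_sum => s.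
by apply: Ck_extM; [exact: Ck_ext_cst|exact: Ck_ext_prod].
Qed.

(** By the cofactor formula only the determinant has to be inverted, and [Ck_extV] asks that it be
    nonzero at the base point alone. *)
Lemma Ck_ext_invmx k m (B : R -> 'rV[R]_n -> 'M[R]_m) i j :
  (forall t z, times T t -> A z -> B t z \in unitmx) ->
  (forall i j, Ck_ext k (fun t z => B t z i j)) ->
  Ck_ext k (fun t z => invmx (B t z) i j).
Proof.
move=> Bu CB.
apply: (@Ck_ext_eq _ (fun t z => (\det (B t z))^-1 * cofactor (B t z) j i)).
  by move=> t z tT Az; rewrite /invmx Bu// !mxE.
apply: Ck_extM.
  apply: Ck_extV; last exact: Ck_ext_det.
  by have := Bu _ _ t0T z0A; rewrite unitmxE unitfE.
rewrite /cofactor; apply: Ck_extM; first exact: Ck_ext_cst.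
apply: Ck_ext_det => i' j'.
by apply: Ck_ext_eq (CB (lift j i') (lift i j')) => t z _ _; rewrite !mxE.
Qed.

(** A partial derivative in space is the derivative of the extension in the direction
    [(0, delta_mx 0 i)]. The time stays fixed while differentiating, so it may be 0; only the
    openness of [A] is used to pass from [phi] to its extension. *)
Lemma Ck_ext_partial k phi i : Ck_ext k.+1 phi ->
  Ck_ext k (fun t z => partial i (phi t) z).
Proof.
move=> [U [F [oU U0 /Ck_succ[Fc Fd FD] FE]]].
pose e : R^o * 'rV[R]_n := (0, delta_mx 0 i).
exists U, ('D_e F); split => // t z Utz tT Az.
have -> : partial i (phi t) z = 'D_(delta_mx 0 i) (fun y => F (t : R^o, y)) z.
  rewrite /partial; apply: near_eq_derive.
  have n1 : \forall y \near z, A y by exact: open_nbhs_nbhs.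
  have pc : (t : R^o, y) @[y --> z] --> (t : R^o, z).
    exact: (@cvg_pair _ _ _ (nbhs z) (nbhs (t : R^o)) (nbhs z) _ _ _ (fun=> t : R^o)
      id (cvg_cst (t : R^o)) cvg_id).
  have n2 : \forall y \near z, U (t : R^o, y).
    by apply: pc; exact: open_nbhs_nbhs.
  by near=> y; rewrite FE//; near: y.
have EE : (fun s : R => s^-1 *: (F (s *: e + (t : R^o, z)) - F (t : R^o, z))) =
    (fun s : R => s^-1 *: (F (t : R^o, s *: delta_mx 0 i + z) - F (t : R^o, z))).
  apply/funext => s; congr (_ *: (F _ - _)).
  rewrite /e; apply/pair_equal_spec; split => //=.
  by rewrite [s *: 0]mulr0 add0r.
by rewrite /derive EE.
Unshelve. all: by end_near. Qed.

Lemma Ck_ext_bounded phi : Ck_ext 0 phi -> exists K, exists2 e : R, 0 < e &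
  forall t z, `|t0 - t| < e -> `|z0 - z| < e -> times T t -> A z -> phi t z <= K.
Proof.
move=> [U [F [oU U0 CF FE]]].
have Fc : {for (t0 : R^o, z0), continuous F} by exact: Ck_continuous CF U0.
have n1 : \forall x \near (t0 : R^o, z0), U x by exact: open_nbhs_nbhs.
have n2 : \forall x \near (t0 : R^o, z0), F x < F (t0 : R^o, z0) + 1.
  by move/cvgr_lt : Fc; apply; rewrite ltrDl.
have : \forall x \near (t0 : R^o, z0), U x /\ F x < F (t0 : R^o, z0) + 1.
  by near=> x; split; near: x.
move=> /nbhs_ballP[e /= e0 eP]; exists (F (t0 : R^o, z0) + 1), e => // t z te ze tT Az.
have [|Utz /ltW] := eP (t : R^o, z).
  by split => /=; rewrite -ball_normE.
by rewrite FE.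
Unshelve. all: by end_near. Qed.

End local_extension.

Section curvature_bound.
Context {R : realType} {n : nat} (M : manifold R n).

Lemma riemann_norm_locally_bounded (T : \bar R) (g : R -> field2 M) (a : chart M)
    (t0 : R) (z0 : 'rV[R]_n) : ricci_flow T g -> times T t0 ->
  (coord a @` dom a) z0 ->
  exists K, exists2 e : R, 0 < e & forall t z, `|t0 - t| < e -> `|z0 - z| < e ->
    times T t -> (coord a @` dom a) z -> riemann_norm (g t a) z <= K.
Proof.
move=> [_ gm gs _] t0T z0A; set A := coord a @` dom a.
have oA : open A by exact: image_open.
pose E k phi := Ck_ext T A t0 z0 k phi.
have gE k i j : E k (fun t z => g t a z i j).
  have [U [F [oU U0 CF FE]]] := gs a i j (t0 : R^o, z0) (conj t0T z0A).
  by exists U, F; split => // t z Utz tT Az; rewrite FE.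
have gu t z : times T t -> A z -> g t a z \in unitmx.
  move=> tT [x ax <-]; exact: posdef_unitmx (is_metric_posdef (gm _ tT) ax).
have iE k i j : E k (fun t z => invmx (g t a z) i j)
  by exact: (@Ck_ext_invmx R n T A t0 z0 t0T z0A k n (fun t z => g t a z) i j gu (gE k)).
have dE k i j l : E k (fun t z => partial i (fun y => g t a y j l) z).
  exact: (Ck_ext_partial oA (phi := fun t y => g t a y j l) i (gE k.+1 j l)).
have cE k l i j : E k (fun t z => christoffel (g t a) l i j z).
  rewrite /christoffel; apply: Ck_extM; first exact: Ck_ext_cst.
  apply: Ck_ext_sum => m; apply: Ck_extM; first exact: iE.
  by apply: Ck_extB; [apply: Ck_extD; exact: dE|exact: dE].
have rE i j k l : E 0%N (fun t z => riemann (g t a) i j k l z).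
  rewrite /riemann; apply: Ck_extD.
    apply: Ck_extB.
      exact: (Ck_ext_partial oA (phi := fun t => christoffel (g t a) l j k)
        i (cE 1%N l j k)).
    exact: (Ck_ext_partial oA (phi := fun t => christoffel (g t a) l i k)
      j (cE 1%N l i k)).
  apply: Ck_ext_sum => m; apply: Ck_extB; apply: Ck_extM; exact: cE.
have [K [e e0 eP]] : exists K, exists2 e : R, 0 < e & forall t z, `|t0 - t| < e ->
    `|z0 - z| < e -> times T t -> A z ->
    \sum_(i < n) \sum_(j < n) \sum_(k < n) \sum_(l < n)
    \sum_(a' < n) \sum_(b < n) \sum_(c < n) \sum_(d < n)
    invmx (g t a z) i a' * invmx (g t a z) j b * invmx (g t a z) k c * g t a z l d *
    riemann (g t a) i j k l z * riemann (g t a) a' b c d z <= K.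
  apply: Ck_ext_bounded => //.
  do 8!(apply: Ck_ext_sum => ?).
  apply: Ck_extM; last exact: rE.
  apply: Ck_extM; last exact: rE.
  apply: Ck_extM; last exact: gE.
  apply: Ck_extM; last exact: iE.
  by apply: Ck_extM; exact: iE.
exists (Num.sqrt K), e => // t z te ze tT Az.
by rewrite /riemann_norm ler_wsqrtr// eP.
Qed.

End curvature_bound.

(** * Lipschitz continuity of the Riemann scale *)

Section riemann_scale_lipschitz.
Context {R : realType} {n : nat} (M : manifold R n) (T : \bar R) (g : R -> field2 M).
Hypothesis gf : ricci_flow T g.

Definition good_radius (p : M) (t : R) : set R := [set r : R | 0 < r /\
  forall x s, parabolic_cylinder T g p t r (x, s) -> riemann_lt (g s) x (r ^- 2)].

Lemma riemann_ltW (h : field2 M) x c c' : c <= c' -> riemann_lt h x c ->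
  riemann_lt h x c'.
Proof. by move=> cc [a ax ac]; exists a => //; exact: lt_le_trans cc. Qed.

Lemma in_parabolic_cylinder p t r x s : parabolic_cylinder T g p t r (x, s) <->
  [/\ (dist (g t) p x < r%:E)%E, `|t - s| < r ^+ 2, 0 < s & (s%:E < T)%E].
Proof.
rewrite /parabolic_cylinder; split=> [[/= dx [+ +]]|[dx ts s0 sT]].
  rewrite gt_max lt_min lte_fin => /andP[ts s0] /andP[st sT].
  by split => //; rewrite ltr_norml; apply/andP; split; lra.
move: ts; rewrite ltr_norml => /andP[ts st]; split => //=; split.
  by rewrite gt_max s0 andbT; lra.
by rewrite lt_min sT andbT lte_fin; lra.
Qed.

Lemma invr_sqr_le (r r' : R) : 0 < r' -> r' <= r -> r ^- 2 <= r' ^- 2.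
Proof.
move=> r'0 rr; rewrite lef_pV2 ?posrE ?exprn_gt0//; last exact: lt_le_trans rr.
by rewrite ler_pXn2r// nnegrE ltW// (lt_le_trans r'0).
Qed.

Lemma good_radius_exists p t : times T t -> exists r, good_radius p t r.
Proof.
move=> tT; have [a ap] := chart_cover p; have [_ gm _ _] := gf.
have az : (coord a @` dom a) (coord a p) by exists p.
have [K [e e0 eP]] := riemann_norm_locally_bounded gf tT az.
have [|d d0 dP] := @small_ball _ _ _ _ a p (ball (coord a p) e) (gm _ tT) ap.
  exact: nbhsx_ballx.
have K0 : 0 < `|K| + 2 by rewrite ltr_wpDl.
(* [d] keeps the ball in the chart. Since [r <= 1], also [r ^+ 2 <= r]; hence [e] controls the time
   window, and [r ^- 2] is at least [|K| + 2], which exceeds [K]. *)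
pose r := Num.min d (Num.min 1 (Num.min e (`|K| + 2)^-1)).
have r0 : 0 < r by rewrite !lt_min d0 ltr01 e0 invr_gt0.
have rd : r <= d by rewrite ge_min lexx.
have r1 : r <= 1 by rewrite !ge_min lexx orbT.
have re : r <= e by rewrite !ge_min lexx !orbT.
have rK : r <= (`|K| + 2)^-1 by rewrite !ge_min lexx !orbT.
have r2 : r ^+ 2 <= r by rewrite expr2 ler_piMr// ltW.
exists r; split => // x s /in_parabolic_cylinder[dx ts s0 sT].
have [|ax xe] := dP x; first by apply: lt_le_trans dx _; rewrite lee_fin.
exists a => //; apply: (@le_lt_trans _ _ K).
  apply: eP.
  - by apply: lt_le_trans ts _; exact: le_trans re.
  - by rewrite -ball_normE in xe.
  - by split => //; exact: ltW.
  - by exists x.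
apply: (@lt_le_trans _ _ (`|K| + 2)); first by have := ler_norm K; lra.
rewrite -[leLHS]invrK lef_pV2 ?posrE ?exprn_gt0 ?invr_gt0//.
exact: le_trans rK.
Qed.

Lemma good_radius_space p q t r d : times T t -> dist (g t) p q = d%:E ->
  good_radius p t r -> 0 < r - d -> good_radius q t (r - d).
Proof.
move=> tT dE [r0 rP] rd; split => // x s /in_parabolic_cylinder[dx ts s0 sT].
have [_ gm _ _] := gf.
have d0 : 0 <= d by rewrite -lee_fin -dE dist_ge0.
have rr : r - d <= r by rewrite lerBlDr lerDl.
apply: riemann_ltW (invr_sqr_le rd rr) _; apply: rP.
apply/in_parabolic_cylinder; split => //; last first.
  by apply: lt_le_trans ts _; rewrite ler_pXn2r// nnegrE ltW.
have := dist_ge0 (g t) q x; case E : (dist (g t) q x) dx => [y| |]//.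
rewrite lte_fin => yr _.
(* The slack [r - d - y] is shared equally, as the triangle inequality is available for strict
   bounds only. *)
have -> : r = (d + (r - d - y) / 2) + (y + (r - d - y) / 2) by field.
apply: (@dist_triangle_lt _ _ _ _ _ q); first exact: gm.
  by rewrite dE lte_fin; lra.
by rewrite E lte_fin; lra.
Qed.

Let C : R := n%:R ^+ 3 + 1.

(** With [x = q / r], the shrunk radius is [(1 - (c + 1) * x) * r], and [1 - (c + 1) * x] is at most
    [expR (- ((c + 1) * x))]. This absorbs the distortion [expR (c * x ^+ 2)] because [x <= 1]. *)
Lemma expR_shrink_le (c r q : R) : 0 <= c -> 0 < r -> 0 <= q ->
  0 < r - (c + 1) * q ->
  expR (c * r ^- 2 * q ^+ 2) * (r - (c + 1) * q) <= r.
Proof.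
move=> c0 r0 q0 rq; pose x := q / r.
have qE : q = x * r by rewrite /x mulfVK// gt_eqF.
have x0 : 0 <= x by rewrite divr_ge0// ltW.
have cq : q <= (c + 1) * q by rewrite ler_peMl// lerDr.
have x1 : x <= 1 by rewrite ler_pdivrMr// mul1r; lra.
have -> : c * r ^- 2 * q ^+ 2 = c * x ^+ 2.
  by rewrite qE; field; rewrite gt_eqF.
have -> : r - (c + 1) * q = (1 + - ((c + 1) * x)) * r by rewrite {1}qE; ring.
rewrite mulrA -[leRHS]mul1r ler_wpM2r ?(ltW r0)//.
apply: (@le_trans _ _ (expR (c * x ^+ 2) * expR (- ((c + 1) * x)))).
  by rewrite ler_wpM2l ?expR_ge0// expR_ge1Dx.
rewrite -expRD -[leRHS]expR0 ler_expR.
have : c * x ^+ 2 <= c * x by rewrite ler_wpM2l// expr2 ler_piMr.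
by rewrite mulrDl mul1r; lra.
Qed.

Lemma good_radius_time p t s r : times T t -> times T s ->
  good_radius p t r -> 0 < r - C * Num.sqrt `|t - s| ->
  good_radius p s (r - C * Num.sqrt `|t - s|).
Proof.
move=> tT sT [r0 rP]; set q := Num.sqrt _ => rq.
have q0 : 0 <= q by exact: sqrtr_ge0.
have qq : q ^+ 2 = `|t - s| by rewrite sqr_sqrtr.
have C1 : 1 <= C by rewrite lerDr exprn_ge0.
have Cq : q <= C * q by rewrite ler_peMl.
have Cqr : C * q < r by rewrite -subr_gt0.
have qr2 : q ^+ 2 < r ^+ 2.
  by rewrite ltr_pXn2r// ?nnegrE// ?ltW//; exact: le_lt_trans Cqr.
have rr : r - C * q <= r by rewrite lerBlDr lerDl (le_trans q0).
(* Nesting of the time windows: a time within [(r - C * q) ^+ 2] of [s] is within [r ^+ 2] of [t].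
   This is where [1 <= C] enters. *)
have pyth : q ^+ 2 + (r - C * q) ^+ 2 <= r ^+ 2.
  rewrite -subr_ge0.
  have -> : r ^+ 2 - (q ^+ 2 + (r - C * q) ^+ 2) =
      q * (2 * C * (r - C * q) + (C * (C * q) - q)) by ring.
  apply: mulr_ge0 => //; apply: addr_ge0.
    by rewrite !mulr_ge0 ?(ltW rq)// (le_trans ler01).
  by rewrite subr_ge0 (le_trans Cq)// ler_peMl// (le_trans q0).
split => // x u /in_parabolic_cylinder[dx su u0 uT].
apply: riemann_ltW (invr_sqr_le rq rr) _; apply: (rP).
apply/in_parabolic_cylinder; split => //; last first.
  apply: (@le_lt_trans _ _ (`|t - s| + `|s - u|)).
    by rewrite (le_trans _ (ler_normD _ _))// addrA subrK.
  by rewrite -qq; apply: lt_le_trans pyth; rewrite ltrD2l.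
apply: (ball_compare gf tT sT _ _ dx); last first.
  by rewrite -qq; apply: expR_shrink_le => //; exact: exprn_ge0.
move=> y v dy vts; apply: rP; apply/in_parabolic_cylinder; split => //.
- apply: le_lt_trans qr2; rewrite qq.
  move: vts => /andP[]; have [ts|st] := leP t s => v1 v2.
    by rewrite !ler0_norm; lra.
  by rewrite !ger0_norm; lra.
- case/andP: vts => v1 _; apply: le_lt_trans v1; rewrite le_min.
  by have [[-> _] [-> _]] := (tT, sT).
- case/andP: vts => _ v2.
  apply: (@lt_trans _ _ (Num.max t s)%:E); first by rewrite lte_fin.
  by have [[_ tT'] [_ sT']] := (tT, sT); case: (leP t s).
Qed.

Let scale (p : M) (t : R) : \bar R := ereal_sup [set r%:E | r in good_radius p t].

Lemma scale_gt0 p t : times T t -> (0 < scale p t)%E.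
Proof.
move=> /(good_radius_exists p)[r rg]; have [r0 _] := rg.
apply: (@lt_le_trans _ _ r%:E); first by rewrite lte_fin.
by apply: ereal_sup_ubound; exists r.
Qed.

(** One move in space and one in time lead from [(p, t)] to [(q, s)]. The space move is made at time
    [t] before the time move, or at time [s] after it, according to which distance [D] is; this
    yields the minimum of the two. *)
Lemma scale_le p q t s (D : \bar R) : times T t -> times T s ->
  D = dist (g t) p q \/ D = dist (g s) p q ->
  (scale p t <= scale q s + (D + (C * Num.sqrt `|t - s|)%:E))%E.
Proof.
move=> tT sT DE; set c := C * _.
have sc0 := scale_gt0 q sT.
have c0 : 0 <= c by rewrite mulr_ge0 ?sqrtr_ge0// addr_ge0// exprn_ge0.
have D0 : (0 <= D)%E by case: DE => ->; exact: dist_ge0.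
case E : D D0 => [d| |]// D0; last first.
  by rewrite addye// addey ?leey// gt_eqF// (lt_trans _ sc0)// ltNy0.
rewrite lee_fin in D0; apply: ge_ereal_sup => _ [r rg <-].
have key : 0 < r - d - c -> ((r - d - c)%:E <= scale q s)%E.
  move=> rdc; apply: ereal_sup_ubound; exists (r - d - c) => //.
  case: DE => DE.
    apply: good_radius_time => //.
    by apply: (@good_radius_space p) => //; [rewrite -DE|lra].
  rewrite addrAC; apply: (@good_radius_space p) => //; first by rewrite -DE.
    by apply: good_radius_time => //; rewrite -/c; lra.
  by rewrite addrAC.
have [rdc|rdc] := ltP 0 (r - d - c).
  have -> : r%:E = ((r - d - c)%:E + (d%:E + c%:E))%E.
    by rewrite -!EFinD; congr EFin; ring.
  by rewrite leeD2r// key.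
(* Here the radius is used up by the two moves: [r <= d + c], and positivity of the other scale is
   enough. *)
rewrite -[leLHS]add0e; apply: leeD; first exact: ltW.
by rewrite -EFinD lee_fin; lra.
Qed.

Lemma dist_sym (h : field2 M) p q : is_metric h -> dist h p q = dist h q p.
Proof. by move=> hm; apply/eqP; rewrite eq_le !dist_sym_le. Qed.

Lemma abs_diff_le (A B e : \bar R) : (0 < A)%E -> (0 < B)%E -> (0 <= e)%E ->
  (A <= B + e)%E -> (B <= A + e)%E -> (abs_diff A B <= e)%E.
Proof.
move=> A0 B0 e0 AB BA; rewrite /abs_diff; case: eqP => // nAB.
case: A B e A0 B0 e0 AB BA nAB => [A| |] [B| |] [e| |] //=;
  rewrite ?leey//= !lte_fin ?lee_fin => A0 B0 e0 AB BA _.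
by rewrite ler_norml; apply/andP; split; lra.
Qed.

Lemma riemann_scale_lipschitz p q t s : times T t -> times T s ->
  (abs_diff (riemann_scale T g p t) (riemann_scale T g q s)
     <= mine (dist (g t) p q) (dist (g s) p q)
        + (C * Num.sqrt `|t - s|)%:E)%E.
Proof.
move=> tT sT; have [_ gm _ _] := gf.
have c0 : 0 <= C * Num.sqrt `|t - s|.
  by rewrite mulr_ge0 ?sqrtr_ge0// addr_ge0// exprn_ge0.
have e0 : (0 <= mine (dist (g t) p q) (dist (g s) p q) +
    (C * Num.sqrt `|t - s|)%:E)%E.
  apply: adde_ge0; last by rewrite lee_fin.
  by rewrite le_min; apply/andP; split; exact: dist_ge0.
rewrite /riemann_scale; case: asboolP => _.
  (* Flatness concerns the whole flow, so both scales are [+oo] and their difference is 0 by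
     convention. *)
  by rewrite /abs_diff eqxx.
rewrite -/(scale p t) -/(scale q s).
apply: abs_diff_le => //; [exact: scale_gt0|exact: scale_gt0| |].
  apply: scale_le => //.
  by case: leP => _; [left|right].
rewrite distrC; apply: scale_le => //.
rewrite (dist_sym p q (gm _ tT)) (dist_sym p q (gm _ sT)).
by case: leP => _; [right|left].
Qed.

End riemann_scale_lipschitz.

Theorem theorem2p2 (R : realType) (n : nat) :
  exists C1 : R,
    forall (M : manifold R n) (T : \bar R) (g : R -> field2 M),
      ricci_flow T g ->
      (forall t : R, times T t -> complete_metric (g t)) ->
      forall (p q : M) (t s : R), times T t -> times T s ->
        (abs_diff (riemann_scale T g p t) (riemann_scale T g q s)
           <= mine (dist (g t) p q) (dist (g s) p q)
              + (C1 * Num.sqrt `|t - s|)%:E)%E.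
Proof.
exists (n%:R ^+ 3 + 1) => M T g gf _ p q t s tT sT.
exact: riemann_scale_lipschitz.
Qed.
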